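(* Let $P\subset\mathbb R^n$ be an $n$-dimensional convex polytope. Then $P$ is monotypic if and only if the following holds: whenever some $n+1$ elements of $N(P)$ are in conical position, their positive hull contains another element of $N(P)$ (i.e. an element of $N(P)$ different from these $n+1$ vectors).
   Context: $N(P)$ is the finite set of outward unit normal vectors of the facets of $P$. $P$ is monotypic if every polytope $Q$ with $N(Q)=N(P)$ is combinatorially equivalent to $P$. A set of points is separated from $0$ if some hyperplane strictly separates the set from the origin $0$. A finite set of points is in conical position if it is separated from $0$ and none of its points lies in the positive hull (the set of nonnegative linear combinations) of the others. *)

(* Defs.v *)
From HB Require Import structures.
From mathcomp Require Import all_boot all_order all_algebra.
From mathcomp Require Import all_classical reals.

Set Implicit Arguments.
Unset Strict Implicit.
Unset Printing Implicit Defensive.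

Import Order.TTheory GRing.Theory Num.Theory.

Local Open Scope classical_set_scope.
Local Open Scope ring_scope.

Section Polytopes.
Variables (R : realType) (n : nat).
Implicit Types (u v x y : 'rV[R]_n) (A P Q F G : set 'rV[R]_n).

Definition dot u v : R := \sum_(i < n) u ord0 i * v ord0 i.

(* The norm `|u| that MathComp-Analysis puts on matrices is the sup norm. *)
Definition enorm u : R := Num.sqrt (dot u u).

Definition conv_hull A : set 'rV[R]_n :=
  [set x | exists (m : nat) (v : 'I_m -> 'rV[R]_n) (c : 'I_m -> R),
     [/\ forall i, A (v i), forall i, 0 <= c i,
         \sum_(i < m) c i = 1 & x = \sum_(i < m) c i *: v i]].

Definition pos_hull A : set 'rV[R]_n :=
  [set x | exists (m : nat) (v : 'I_m -> 'rV[R]_n) (c : 'I_m -> R),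
     [/\ forall i, A (v i), forall i, 0 <= c i
       & x = \sum_(i < m) c i *: v i]].

Definition aff_indep (k : nat) (p : 'I_k.+1 -> 'rV[R]_n) : Prop :=
  row_free (\matrix_(i < k) (p (lift ord0 i) - p ord0)).

(* Affine dimension k: the largest affinely independent families of points
   of A have k + 1 members. The empty set has no dimension in this sense. *)
Definition has_dim A (k : nat) : Prop :=
  (exists2 p : 'I_k.+1 -> 'rV[R]_n, forall i, A (p i) & aff_indep p) /\
  ~ (exists2 p : 'I_k.+2 -> 'rV[R]_n, forall i, A (p i) & aff_indep p).

Definition polytope P : Prop :=
  exists2 A, finite_set A & P = conv_hull A.

Definition full_polytope P : Prop := polytope P /\ has_dim P n.

Definition exposed_face P u : set 'rV[R]_n :=
  [set x | P x /\ forall y, P y -> dot u y <= dot u x].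

(* Both improper faces are included: P itself is the case u = 0. *)
Definition face P F : Prop := F = set0 \/ exists u, F = exposed_face P u.

Definition facet P F : Prop :=
  face P F /\ exists2 k : nat, k.+1 = n & has_dim F k.

Definition outer_unit_normal P F u : Prop :=
  enorm u = 1 /\ F = exposed_face P u.

Definition facet_normals P : set 'rV[R]_n :=
  [set u | exists2 F, facet P F & outer_unit_normal P F u].

(* Isomorphism of the face lattices. *)
Definition comb_equiv P Q : Prop :=
  exists2 f : set 'rV[R]_n -> set 'rV[R]_n,
    set_bij [set F | face P F] [set F | face Q F] f
    & forall F G, face P F -> face P G -> (F `<=` G <-> f F `<=` f G).

Definition monotypic P : Prop :=
  forall Q, full_polytope Q -> facet_normals Q = facet_normals P ->
    comb_equiv Q P.

Definition separated_from_0 A : Prop :=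
  exists (a : 'rV[R]_n) (b : R),
    [/\ a != 0, dot a 0 < b & forall x, A x -> b < dot a x].

Definition conical_position A : Prop :=
  [/\ finite_set A, separated_from_0 A
    & forall x, A x -> ~ pos_hull (A `\ x) x].

End Polytopes.

(* Main.v *)
Require Import Defs.
From HB Require Import structures.
From mathcomp Require Import all_boot all_order all_algebra.
From mathcomp Require Import all_classical reals.
From mathcomp Require Import ring lra zify.

Set Implicit Arguments.
Unset Strict Implicit.
Unset Printing Implicit Defensive.

Import Order.TTheory GRing.Theory Num.Theory.

Local Open Scope classical_set_scope.
Local Open Scope card_scope.
Local Open Scope ring_scope.

(* A full-dimensional polytope is [{x | u_i . x <= h_i}] with the [u_i] its facet
   normals, no inequality being redundant; write [T x] for the set of indices
   tight at [x].  The sets [T x] determine the face lattice.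

   If the positive hull of [n+1] normals in conical position contains no other
   normal, then some choice of [h] makes exactly these facets meet at the origin,
   whereas a generic choice of [h] gives a polytope with the same normals in which
   no [n+1] facets have a common point.  These two are not equivalent, since facets
   are the coatoms of the face lattice.

   Conversely, each [T x] is in conical position and contains every normal of its
   positive hull, so under the condition it has at most [n] elements, and, being
   contained in some [T y] that spans, it is linearly independent.  The segment
   between two admissible right-hand sides [h], [h'] consists of admissible ones.
   The times at which a given set of facets has a common point form a closed set,
   which by independence is also open to the right; so the families of sets [T x]
   for [h] and [h'] coincide. *)

(** * Scalar product, small parameters *)

Section Dot.
Variables (R : realType) (n : nat).
Implicit Types u v x y : 'rV[R]_n.

Lemma dotC u v : dot u v = dot v u.
Proof. by apply: eq_bigr => i _; rewrite mulrC. Qed.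

Lemma dotDr u x y : dot u (x + y) = dot u x + dot u y.
Proof. by rewrite -big_split; apply: eq_bigr => i _; rewrite mxE mulrDr. Qed.

Lemma dotZr u c x : dot u (c *: x) = c * dot u x.
Proof. by rewrite mulr_sumr; apply: eq_bigr => i _; rewrite mxE mulrCA. Qed.

Lemma dotNr u x : dot u (- x) = - dot u x.
Proof. by rewrite -scaleN1r dotZr mulN1r. Qed.

Lemma dotBr u x y : dot u (x - y) = dot u x - dot u y.
Proof. by rewrite dotDr dotNr. Qed.

Lemma dot0r u : dot u 0 = 0.
Proof. by rewrite -(scale0r 0) dotZr mul0r. Qed.

Lemma dotDl u v x : dot (u + v) x = dot u x + dot v x.
Proof. by rewrite dotC dotDr !(dotC x). Qed.

Lemma dotZl c u x : dot (c *: u) x = c * dot u x.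
Proof. by rewrite dotC dotZr dotC. Qed.

Lemma dotNl u x : dot (- u) x = - dot u x.
Proof. by rewrite dotC dotNr dotC. Qed.

Lemma dotBl u v x : dot (u - v) x = dot u x - dot v x.
Proof. by rewrite dotDl dotNl. Qed.

Lemma dot0l x : dot 0 x = 0.
Proof. by rewrite dotC dot0r. Qed.

Lemma dot_sumr (I : Type) (r : seq I) (P : pred I) (F : I -> 'rV[R]_n) u :
  dot u (\sum_(i <- r | P i) F i) = \sum_(i <- r | P i) dot u (F i).
Proof. by apply: (big_morph (dot u)); [exact: dotDr|exact: dot0r]. Qed.

Lemma dot_suml (I : Type) (r : seq I) (P : pred I) (F : I -> 'rV[R]_n) x :
  dot (\sum_(i <- r | P i) F i) x = \sum_(i <- r | P i) dot (F i) x.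
Proof. by rewrite dotC dot_sumr; apply: eq_bigr => i _; rewrite dotC. Qed.

Lemma dot_delta x i : dot (delta_mx 0 i) x = x 0 i.
Proof.
rewrite /dot (bigD1 i) //= big1 ?addr0 => [|j ji]; rewrite mxE eqxx /=.
  by rewrite mul1r.
by rewrite (negbTE ji) mul0r.
Qed.

Lemma dot_gt0 u : u != 0 -> 0 < dot u u.
Proof.
move=> u0; have uu0 : 0 <= dot u u by apply: sumr_ge0 => i _; rewrite -expr2 sqr_ge0.
rewrite lt_neqAle uu0 andbT eq_sym; apply: contraNneq u0 => uu.
apply/eqP/rowP => i; rewrite mxE; apply/eqP; rewrite -sqrf_eq0 expr2.
move/psumr_eq0P: uu => ->//= j _; by rewrite -expr2 sqr_ge0.
Qed.

Lemma enorm_eq1 u : (enorm u = 1) <-> (dot u u = 1).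
Proof.
have uu0 : 0 <= dot u u by apply: sumr_ge0 => i _; rewrite -expr2 sqr_ge0.
rewrite /enorm; split=> [uu|->]; last by rewrite sqrtr1.
by rewrite -(sqr_sqrtr uu0) uu expr1n.
Qed.

Lemma dot_mulmx u x : u *m x^T = (dot u x)%:M.
Proof.
apply/matrixP => i j; rewrite !ord1 !mxE eqxx mulr1n.
by apply: eq_bigr => k _; rewrite mxE.
Qed.

Lemma dot_unit_lt1 u v : dot u u = 1 -> dot v v = 1 -> u != v -> dot u v < 1.
Proof.
move=> uu vv; rewrite -subr_eq0 => /dot_gt0.
rewrite dotBl !dotBr uu vv (dotC v u); lra.
Qed.

End Dot.

Section ForSmall.
Variable R : realType.

(** Stable under finite conjunction, so that one small parameter serves finitely many strict
    inequalities. *)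
Definition for_small (P : R -> Prop) : Prop :=
  exists2 e0, 0 < e0 & forall e, 0 < e <= e0 -> P e.

Lemma for_small_ex P : for_small P -> exists2 e, 0 < e & P e.
Proof. by case=> e e0 h; exists e => //; apply: h; rewrite e0 lexx. Qed.

Lemma for_smallT (P : R -> Prop) : (forall e, 0 < e -> P e) -> for_small P.
Proof. by move=> h; exists 1 => // e /andP[e0 _]; apply: h. Qed.

Lemma for_small_and P Q :
  for_small P -> for_small Q -> for_small (fun e => P e /\ Q e).
Proof.
move=> [a a0 hP] [b b0 hQ]; exists (Num.min a b) => [|e].
  by rewrite lt_min a0.
by rewrite le_min => /and3P[e0 ea eb]; split; [apply: hP|apply: hQ]; rewrite e0.
Qed.

Lemma for_small_forall (I : finType) (P : I -> R -> Prop) :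
  (forall i, for_small (P i)) -> for_small (fun e => forall i, P i e).
Proof.
move=> h; suff [e0 e00 h0] : for_small (fun e => forall i, i \in enum I -> P i e).
  by exists e0 => // e /h0 hi i; apply: hi; rewrite mem_enum.
elim: (enum I) => [|i s IHs]; first by apply: for_smallT.
have [e0 e00 h0] := for_small_and (h i) IHs.
exists e0 => // e /h0[hi hs] j; rewrite inE => /orP[/eqP->//|]; exact: hs.
Qed.

Lemma for_small_in (T : eqType) (s : seq T) (P : T -> R -> Prop) :
  (forall i, i \in s -> for_small (P i)) ->
  for_small (fun e => forall i, i \in s -> P i e).
Proof.
elim: s => [|i s IHs] h; first by apply: for_smallT.
have hs : forall j, j \in s -> for_small (P j).
  by move=> j js; apply: h; rewrite inE js orbT.
have [e0 e00 h0] := for_small_and (h i (mem_head _ _)) (IHs hs).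
exists e0 => // e /h0[hi hs'] j; rewrite inE => /orP[/eqP->//|]; exact: hs'.
Qed.

Lemma for_small_lt a b c : a < b -> for_small (fun e => a + e * c < b).
Proof.
move=> ab; have c1 : 0 < `|c| + 1 by rewrite ltr_wpDl.
(* The added 1 keeps the denominator positive when [c] is 0; the half makes the final inequality
   strict. *)
exists ((b - a) / (`|c| + 1) / 2) => [|e /andP[e0]].
  by rewrite !divr_gt0 // subr_gt0.
rewrite ler_pdivlMr // ler_pdivlMr // => le.
have := ler_norm (e * c); rewrite normrM (gtr0_norm e0) => h; nra.
Qed.

Lemma for_small_neq a c : a != 0 -> for_small (fun e => a + e * c != 0).
Proof.
rewrite neq_lt => /orP[a0|a0].
  have [e0 e00 h] := for_small_lt c a0.
  by exists e0 => // e /h; rewrite neq_lt => ->.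
have [|e0 e00 h] := @for_small_lt (- a) 0 (- c); first by rewrite oppr_lt0.
by exists e0 => // e /h; rewrite mulrN -opprD oppr_lt0 neq_lt => ->; rewrite orbT.
Qed.

End ForSmall.

(** * Finitely generated cones *)

Section Weyl.
Variables (R : realType) (n : nat).
Implicit Types (x a b : 'rV[R]_n) (A : set 'rV[R]_n) (s : seq 'rV[R]_n).

Lemma pos_hull_min A (K : 'rV[R]_n -> Prop) : K 0 ->
  (forall x y, K x -> K y -> K (x + y)) ->
  (forall c x, 0 <= c -> A x -> K (c *: x)) ->
  forall x, pos_hull A x -> K x.
Proof.
move=> K0 KD KZ x [m [v [c [Av c0 ->]]]].
by apply: (big_ind K) => // i _; apply: KZ.
Qed.

Lemma pos_hull0 A : pos_hull A 0.
Proof. by exists 0%N, (fun=> 0), (fun=> 0); split=> [[]||] //; rewrite big_ord0. Qed.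

Lemma pos_hullZ_mem A c x : 0 <= c -> A x -> pos_hull A (c *: x).
Proof. by move=> c0 Ax; exists 1%N, (fun=> x), (fun=> c); split=> //; rewrite big_ord1. Qed.

Lemma pos_hullD A x y : pos_hull A x -> pos_hull A y -> pos_hull A (x + y).
Proof.
move=> [m [v [c [Av c0 ->]]]] [m' [v' [c' [Av' c0' ->]]]].
exists (m + m')%N, (fun i => match fintype.split i with inl j => v j | inr j => v' j end),
  (fun i => match fintype.split i with inl j => c j | inr j => c' j end).
split; try by move=> i; case: (fintype.split i).
rewrite big_split_ord; congr (_ + _); apply: eq_bigr => i _.
  by rewrite (unsplitK (inl i)).
by rewrite (unsplitK (inr i)).
Qed.

Lemma pos_hull_subset A B : A `<=` B -> pos_hull A `<=` pos_hull B.
Proof. by move=> AB x [m [v [c [Av c0 ->]]]]; exists m, v, c; split=> // i; apply/AB. Qed.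

Lemma pos_hull_cons a s x :
  pos_hull [set` a :: s] x <-> exists2 t, 0 <= t & pos_hull [set` s] (x - t *: a).
Proof.
split; last first.
  move=> [t t0 h]; rewrite -(subrK (t *: a) x); apply: pos_hullD.
    by move: h; apply: pos_hull_subset => y /= ys; rewrite inE ys orbT.
  by apply: pos_hullZ_mem => //=; rewrite mem_head.
move: x; apply: pos_hull_min.
- by exists 0 => //; rewrite scale0r subr0; exact: pos_hull0.
- move=> x y [t t0 hx] [t' t0' hy]; exists (t + t'); first exact: addr_ge0.
  by rewrite scalerDl opprD addrACA; exact: pos_hullD.
- move=> c x c0 /=; rewrite inE => /orP[/eqP->|xs].
    by exists c => //; rewrite subrr; exact: pos_hull0.
  by exists 0 => //; rewrite scale0r subr0; exact: pos_hullZ_mem.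
Qed.

(** An index with [g i > 0] bounds [t] from below by [f i / g i], one with [g i < 0] bounds it from
    above. The conditions say that no lower bound, 0 included, exceeds an upper bound, and that the
    constraints free of [t] hold. *)
Lemma fourier_motzkin (I : eqType) (s : seq I) (f g : I -> R) :
  (exists2 t, 0 <= t & forall i, i \in s -> f i <= t * g i) <->
  (forall i, i \in s -> g i <= 0 -> f i <= 0) /\
  (forall i j, i \in s -> j \in s -> 0 < g i -> g j < 0 ->
    f i * - g j + f j * g i <= 0).
Proof.
split=> [[t t0 ht]|[h1 h2]].
  split=> [i /ht ft gi|i j /ht fi /ht fj gi gj]; nra.
(* The witness is the largest lower bound. *)
suff [t t0 [ht hmax]] : exists2 t, 0 <= t &
    (forall i, i \in s -> 0 < g i -> f i <= t * g i) /\
    (t = 0 \/ exists2 i, i \in s & 0 < g i /\ f i = t * g i).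
  exists t => // i si; have [gi|gi|gi] := ltgtP (g i) 0; last first.
  - by rewrite gi mulr0; apply: h1; rewrite ?gi.
  - exact: ht.
  case: hmax => [->|[j sj [gj fj]]]; first by rewrite mul0r; apply: h1 => //; exact: ltW.
  have := h2 j i sj si gj gi; rewrite fj => h; nra.
elim: s {h1 h2} => [|i s [t t0 [ht hmax]]]; first by exists 0 => //; split=> //; left.
have [hi|hi] := boolP ((0 < g i) && (t * g i < f i)).
  case/andP: hi => gi fi; exists (f i / g i).
    by rewrite divr_ge0 // ltW //; apply: le_lt_trans fi; nra.
  have e : f i / g i * g i = f i by rewrite divfK // gt_eqF.
  split; last by right; exists i; rewrite ?mem_head.
  move=> j; rewrite inE => /orP[/eqP->|js gj]; first by rewrite e.
  apply: le_trans (ht _ js gj) _; rewrite ler_pM2r //.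
  by rewrite ler_pdivlMr // ltW.
exists t => //; split.
  move=> j; rewrite inE => /orP[/eqP->|js gj]; last exact: ht.
  by move=> gi; move: hi; rewrite gi /= -leNgt.
by case: hmax => [|[j js hj]]; [left|right; exists j => //; rewrite inE js orbT].
Qed.

(** Induction on the generators: [x] lies in the cone of [a :: s] when some [x - t *: a] with
    [t >= 0] lies in the cone of [s], and Fourier-Motzkin elimination removes [t]. *)
Theorem weyl A : finite_set A ->
  exists L : seq 'rV[R]_n, forall x, pos_hull A x <-> forall b, b \in L -> dot b x <= 0.
Proof.
case/finite_seqP => s ->; elim: s => [|a s [L hL]].
  (* The cone without generators is the origin, cut out by both signs of every coordinate. *)
  exists (flatten [seq [:: delta_mx 0 i; - delta_mx 0 i] | i <- enum 'I_n]) => x.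
  split=> [[m [v [c [Av _ ->]]]]|h].
    rewrite big1 => [b _|i _]; first by rewrite dot0r.
    by have := Av i; rewrite /= in_nil.
  suff -> : x = 0 by exact: pos_hull0.
  apply/rowP => i; rewrite mxE; apply/eqP; rewrite eq_le -dot_delta.
  rewrite h /=; last first.
    by apply/flatten_mapP; exists i; rewrite ?mem_enum ?inE ?eqxx.
  rewrite -oppr_le0 -dotNl; apply: h.
  by apply/flatten_mapP; exists i; rewrite ?mem_enum ?inE ?eqxx ?orbT.
exists ([seq b <- L | dot b a <= 0] ++
  [seq (- dot c a) *: b + dot b a *: c | b <- [seq b <- L | 0 < dot b a],
                                          c <- [seq c <- L | dot c a < 0]]) => x.
rewrite pos_hull_cons.
transitivity (exists2 t, 0 <= t & forall b, b \in L -> dot b x <= t * dot b a).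
  split=> -[t t0 h]; exists t => //.
    by move/hL: h => h b /h; rewrite dotBr dotZr subr_le0.
  by apply/hL => b /h; rewrite dotBr dotZr subr_le0.
rewrite fourier_motzkin; split.
  move=> [h1 h2] b; rewrite mem_cat mem_filter => /orP[/andP[ba bL]|]; first exact: h1.
  case/allpairsP => -[c d] /= []; rewrite !mem_filter => /andP[ca cL] /andP[da dL] ->.
  by rewrite dotDl !dotZl mulrC (mulrC (dot c a)); exact: h2.
move=> h; split=> [b bL ba|b c bL cL ba ca].
  by apply: h; rewrite mem_cat mem_filter ba bL.
rewrite mulrC (mulrC (dot c x)) -!dotZl -dotDl; apply: h.
rewrite mem_cat; apply/orP; right; apply/allpairsP; exists (b, c) => /=.
by rewrite !mem_filter ba bL ca cL.
Qed.

Lemma farkas A x : finite_set A -> ~ pos_hull A x ->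
  exists2 b, 0 < dot b x & forall a, A a -> dot b a <= 0.
Proof.
move=> /weyl[L hL] /hL/existsNP[b /not_implyP[bL /negP]]; rewrite -ltNge => bx.
exists b => // a Aa; have /hL h : pos_hull A a; last exact: h.
by rewrite -(scale1r a); exact: pos_hullZ_mem.
Qed.

End Weyl.

(** Homogenization: [x] is in the convex hull when [(x, 1)] is in the cone over the lifted points,
    since the last coordinate records the sum of the coefficients. *)
Lemma conv_hull_halfspaces (R : realType) (n : nat) (A : set 'rV[R]_n) :
  finite_set A -> exists L : seq ('rV[R]_n * R),
    forall x, conv_hull A x <-> forall c, c \in L -> dot c.1 x <= c.2.
Proof.
move=> fA; pose lft (x : 'rV[R]_n) : 'rV[R]_(n + 1) := row_mx x 1%:M.
have [L hL] := weyl (finite_image lft fA).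
exists [seq (lsubmx b, - rsubmx b 0 0) | b <- L] => x.
transitivity (pos_hull (lft @` A) (lft x)).
  split=> [[m [v [c [Av c0 c1 ->]]]]|[m [v [c [Av c0 e]]]]].
    exists m, (lft \o v), c; split=> [i||] //=; first by exists (v i).
    rewrite -[RHS]hsubmxK !linear_sum /= /lft; congr row_mx.
      by apply: eq_bigr => i _; rewrite linearZ /= row_mxKl.
    transitivity (\sum_(i < m) c i *: (1%:M : 'M[R]_1)).
      by rewrite -scaler_suml c1 scale1r.
    by apply: eq_bigr => i _; rewrite linearZ /= row_mxKr.
  exists m, (fun i => lsubmx (v i)), c; split=> // [i||].
  - by have [a Aa <-] := Av i; rewrite row_mxKl.
  - have /(congr1 (fun z : 'rV_(n + 1) => rsubmx z 0 0)) := e.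
    rewrite row_mxKr linear_sum /= summxE mxE eqxx mulr1n => ->.
    apply: eq_bigr => i _; have [a Aa <-] := Av i.
    by rewrite linearZ /= row_mxKr !mxE eqxx mulr1.
  - have /(congr1 lsubmx) := e; rewrite row_mxKl linear_sum /= => ->.
    by apply: eq_bigr => i _; rewrite linearZ.
have dotl (b : 'rV[R]_(n + 1)) : dot b (lft x) = dot (lsubmx b) x + rsubmx b 0 0.
  rewrite /dot big_split_ord big_ord1 /= row_mxEr !mxE eqxx mulr1; congr (_ + _).
  by apply: eq_bigr => i _; rewrite row_mxEl mxE.
rewrite hL; split=> h.
  by move=> _ /mapP[b bL ->] /=; rewrite -subr_le0 opprK -dotl; exact: h.
move=> b bL; rewrite dotl -[rsubmx b 0 0]opprK subr_le0.
exact: (h (_, _) (map_f _ bL)).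
Qed.

(** * Polyhedra and their faces *)

Section HPoly.
Variables (R : realType) (n m : nat) (u : 'I_m -> 'rV[R]_n).
Implicit Types (x y d v : 'rV[R]_n) (h : 'rV[R]_m) (S : {set 'I_m}).

Definition hpoly h : set 'rV[R]_n := [set x | forall i, dot (u i) x <= h 0 i].

Definition active h x : {set 'I_m} := [set i | dot (u i) x == h 0 i].

Definition tight_face h S : set 'rV[R]_n :=
  [set x | hpoly h x /\ S \subset active h x].

(** Excludes directions of recession, which makes the polyhedra [hpoly h] bounded. *)
Definition pos_spanning : Prop :=
  forall d, d != 0 -> exists i, 0 < dot (u i) d.

Definition normal_system : Prop :=
  [/\ forall i, dot (u i) (u i) = 1, injective u & pos_spanning].

(** Phrased by witnesses, an interior point and a relatively interior point of each facet, so that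
    it passes to convex combinations and small perturbations of [h]. *)
Definition irredundant h : Prop :=
  (exists q, forall i, dot (u i) q < h 0 i) /\
  forall i, exists2 p, dot (u i) p = h 0 i &
                       forall j, j != i -> dot (u j) p < h 0 j.

Definition spanning S : Prop :=
  forall d, (forall i, i \in S -> dot (u i) d = 0) -> d = 0.

Lemma normal_system_neq0 i : normal_system -> u i != 0.
Proof.
case=> uu _ _; apply: contra_eq_neq (uu i) => ->.
by rewrite dot0l eq_sym oner_neq0.
Qed.

Lemma activeP h x i : reflect (dot (u i) x = h 0 i) (i \in active h x).
Proof. by rewrite inE; exact: eqP. Qed.

Lemma hpoly_lt h x i : hpoly h x -> i \notin active h x -> dot (u i) x < h 0 i.
Proof. by move=> hx; rewrite inE lt_neqAle => ->; exact: hx. Qed.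

(** Inactive inequalities have slack and survive a small step; an active one stays tight exactly
    when its normal is orthogonal to [d]. *)
Lemma active_move h x d : hpoly h x ->
  (forall i, i \in active h x -> dot (u i) d <= 0) ->
  for_small (fun e => hpoly h (x + e *: d) /\
    active h (x + e *: d) = [set i in active h x | dot (u i) d == 0]).
Proof.
move=> hx hd; have := @for_small_forall R 'I_m (fun i e => i \notin active h x ->
  dot (u i) x + e * dot (u i) d < h 0 i).
case=> [i|e0 e00 he].
  case: (boolP (i \in _)) => [_|/(hpoly_lt hx)/(for_small_lt (dot (u i) d))[e0 e00 he]].
    exact: for_smallT.
  by exists e0 => // e /he.
exists e0 => // e lee; have e_gt0 : 0 < e by case/andP: lee.
split=> [i|].
  rewrite dotDr dotZr; case: (boolP (i \in active h x)) => [ai|/(he _ lee)/ltW//].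
  by have := hd i ai; move/activeP: ai => <- ?; nra.
apply/setP => i; rewrite !inE dotDr dotZr.
case: (boolP (i \in active h x)) => ai.
  have /activeP <- := ai; rewrite eqxx -subr_eq0 addrAC subrr add0r mulf_eq0.
  by rewrite (gt_eqF e_gt0).
by rewrite (lt_eqF (he _ lee _ ai)); move: ai; rewrite inE => /negbTE ->.
Qed.

Lemma active_mid h x y : hpoly h x -> hpoly h y ->
  hpoly h (2^-1 *: (x + y)) /\
  active h (2^-1 *: (x + y)) = active h x :&: active h y.
Proof.
move=> hx hy; split=> [i|].
  by rewrite dotZr dotDr; have := hx i; have := hy i; lra.
apply/setP => i; rewrite !inE dotZr dotDr; have := hx i; have := hy i => yi xi.
apply/eqP/andP => [e|[/eqP -> /eqP ->]]; last by lra.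
by split; apply/eqP; lra.
Qed.

(** The inequalities tight at a midpoint are those tight at both ends, so a point of [K] with the
    fewest active indices has them contained in all others. *)
Lemma min_active h (K : set 'rV[R]_n) : K !=set0 -> K `<=` hpoly h ->
  (forall x y, K x -> K y -> K (2^-1 *: (x + y))) ->
  exists2 x, K x & forall y, K y -> active h x \subset active h y.
Proof.
move=> [z Kz] Kh Kmid.
have : exists k, `[< exists2 x, K x & #|active h x| = k >].
  by exists #|active h z|; apply/asboolP; exists z.
case/ex_minnP => k /asboolP[x Kx xk] kmin; exists x => // y Ky.
have [_ e] := active_mid (Kh _ Kx) (Kh _ Ky).
have := kmin #|active h x :&: active h y|.
rewrite -e => /(_ _)/wrap[|].
  by apply/asboolP; exists (2^-1 *: (x + y)) => //; exact: Kmid.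
rewrite -xk e => le; apply/finset.setIidPl/eqP.
by rewrite eqEcard finset.subsetIl.
Qed.

Lemma exposed_face_active h v : exposed_face (hpoly h) v !=set0 ->
  exists2 x, exposed_face (hpoly h) v x &
    exposed_face (hpoly h) v = tight_face h (active h x).
Proof.
move=> F0; have [x [hx vx] xmin] : exists2 x, exposed_face (hpoly h) v x &
    forall y, exposed_face (hpoly h) v y -> active h x \subset active h y.
  apply: min_active => // [x []//|x y [hx vx] [hy vy]].
  split=> [|z hz]; first by have [] := active_mid hx hy.
  by rewrite dotZr dotDr; have := vx z hz; have := vy z hz; lra.
exists x => //; apply/seteqP; split=> [y Fy|y [hy xy]].
  by split; [case: Fy|exact: xmin].
split=> // z hz; apply: le_trans (vx z hz) _.
(* The segment from [y] to [x] can be prolonged beyond [x] inside the polyhedron; as [x] maximizes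
   [v], the value at [y] cannot be smaller. *)
have [|e e0 [he _]] := for_small_ex (@active_move h x (x - y) hx _).
  move=> i ix; rewrite dotBr; move/fintype.subsetP: xy => /(_ _ ix)/activeP ->.
  by move/activeP: ix => ->; rewrite subrr.
have := vx _ he; rewrite dotDr dotZr dotBr; nra.
Qed.

Lemma face_active h F : face (hpoly h) F -> F !=set0 ->
  exists2 x, hpoly h x & F = tight_face h (active h x).
Proof.
move=> [->[]//|[v ->]] /exposed_face_active[x [hx _] e]; by exists x.
Qed.

(** The sum of the normals in [S] is at most the sum of their bounds, with equality only when every
    slack vanishes. *)
Lemma tight_face_exposed h S x : tight_face h S x ->
  tight_face h S = exposed_face (hpoly h) (\sum_(i in S) u i).
Proof.
move=> [hx Sx]; have xS : dot (\sum_(i in S) u i) x = \sum_(i in S) h 0 i.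
  by rewrite dot_suml; apply: eq_bigr => i /(fintype.subsetP Sx)/activeP.
apply/seteqP; split=> [y [hy Sy]|y [hy ymax]].
  split=> // z hz; rewrite !dot_suml; apply: ler_sum => i /(fintype.subsetP Sy)/activeP ->.
  exact: hz.
split=> //; apply/fintype.subsetP => i iS; apply/activeP.
have hy0 j : j \in S -> 0 <= h 0 j - dot (u j) y by rewrite subr_ge0.
have s0 : \sum_(j in S) (h 0 j - dot (u j) y) = 0.
  apply/eqP; rewrite eq_le sumr_ge0 // andbT sumrB -xS -dot_suml subr_le0.
  exact: ymax.
by have /eqP := psumr_eq0P hy0 s0 iS; rewrite subr_eq0 => /eqP.
Qed.

Lemma tight_face_face h S : tight_face h S !=set0 -> face (hpoly h) (tight_face h S).
Proof. by case=> x /tight_face_exposed ->; right; eexists. Qed.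

Lemma ray_hit h x d : pos_spanning -> hpoly h x -> d != 0 ->
  exists t, [/\ 0 <= t, hpoly h (x + t *: d) &
    exists2 i, 0 < dot (u i) d & i \in active h (x + t *: d)].
Proof.
move=> sp hx /sp[i0 i0d].
(* [r i] is the time at which the ray meets the [i]-th hyperplane; the first meeting is chosen among
   the normals along which it ascends. *)
pose r i := (h 0 i - dot (u i) x) / dot (u i) d.
have [i /= id imin] := @arg_minP _ _ _ i0 (fun i => 0 < dot (u i) d) r i0d.
have ri : r i * dot (u i) d = h 0 i - dot (u i) x by rewrite divfK // gt_eqF.
exists (r i); have r0 : 0 <= r i by rewrite divr_ge0 ?subr_ge0 // ltW.
split=> //; last first.
  by exists i => //; apply/activeP; rewrite dotDr dotZr ri addrC subrK.
move=> j; rewrite dotDr dotZr; case: (ltrP 0 (dot (u j) d)) => jd.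
  by rewrite addrC -lerBrDr -ler_pdivlMr // imin.
by have := hx j; nra.
Qed.

Lemma active_ray h x d t : (forall i, i \in active h x -> dot (u i) d = 0) ->
  active h x \subset active h (x + t *: d).
Proof.
move=> hd; apply/fintype.subsetP => i ix; apply/activeP.
by rewrite dotDr dotZr hd // mulr0 addr0; exact/activeP.
Qed.

Lemma active_hit h x d t i : (forall j, j \in active h x -> dot (u j) d = 0) ->
  0 < dot (u i) d -> i \in active h (x + t *: d) ->
  active h x \proper active h (x + t *: d).
Proof.
move=> hd id iy; apply/properP; split; first exact: active_ray.
by exists i => //; apply: contraTN id => /hd ->; rewrite ltxx.
Qed.

Lemma not_spanning S : ~ spanning S ->
  exists2 d, d != 0 & forall i, i \in S -> dot (u i) d = 0.
Proof. by move=> /existsNP[d /not_implyP[hd /eqP d0]]; exists d. Qed.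

(** Induction on the number of inactive inequalities. *)
Lemma active_ind h (K : 'rV[R]_n -> Prop) :
  (forall x, hpoly h x ->
    (forall y, hpoly h y -> active h x \proper active h y -> K y) -> K x) ->
  forall x, hpoly h x -> K x.
Proof.
move=> IH x; have [k] := ubnP (m - #|active h x|).
elim: k x => // k IHk x lek hx; apply: IH => // y hy xy; apply: IHk => //.
have := fintype.proper_card xy; have := max_card (mem (active h y)); rewrite card_ord.
set a := #|_|; set b := #|_| in lek *; lia.
Qed.

(** While the active normals do not span, moving orthogonally to them reaches a further hyperplane
    and loses none. *)
Lemma vertex_above h x : pos_spanning -> hpoly h x ->
  exists2 y, hpoly h y & active h x \subset active h y /\ spanning (active h y).
Proof.
move=> sp; move: x; apply: active_ind => x hx IH.
have [sx|/not_spanning[d d0 hd]] := pselect (spanning (active h x)); first by exists x.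
have [t [t0 hy [i id iy]]] := ray_hit sp hx d0.
have xy := active_hit hd id iy.
have [z hz [yz sz]] := IH _ hy xy.
by exists z => //; split=> //; apply: fintype.subset_trans yz; exact: fintype.proper_sub.
Qed.

Definition vertices h : set 'rV[R]_n := [set x | hpoly h x /\ spanning (active h x)].

(** A vertex is determined by its active set, because the active normals span. *)
Lemma finite_vertices h : finite_set (vertices h).
Proof.
pose g S := xget (0 : 'rV[R]_n) [set x | vertices h x /\ active h x = S].
apply: (@sub_finite_set _ _ (g @` setT)); last exact: finite_image.
move=> x Vx; exists (active h x) => //.
rewrite /g; case: xgetP => [y _ [[hy sy] e]|/(_ x)[]//].
apply/eqP; rewrite -subr_eq0; apply/eqP; apply: sy => i iy.
rewrite dotBr; have /activeP -> := iy; rewrite e in iy.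
by have /activeP -> := iy; rewrite subrr.
Qed.

End HPoly.

(** * Convex hulls and affine dimension *)

Section Conv.
Variables (R : realType) (n : nat).
Implicit Types (x y : 'rV[R]_n) (A : set 'rV[R]_n).

Lemma conv_hull_mem A x : A x -> conv_hull A x.
Proof.
by move=> Ax; exists 1%N, (fun=> x), (fun=> 1); split=> //; rewrite big_ord1 ?scale1r.
Qed.

Lemma conv_hull_segment A x y t : 0 <= t <= 1 -> conv_hull A x -> conv_hull A y ->
  conv_hull A ((1 - t) *: x + t *: y).
Proof.
move=> /andP[t0 t1] [k [v [c [Av c0 c1 ->]]]] [k' [v' [c' [Av' c0' c1' ->]]]].
exists (k + k')%N, (fun i => match fintype.split i with inl j => v j | inr j => v' j end),
  (fun i => match fintype.split i with inl j => (1 - t) * c j | inr j => t * c' j end).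
split; try by move=> i; case: (fintype.split i) => // j; rewrite mulr_ge0 ?subr_ge0.
- rewrite big_split_ord /=.
  under eq_bigr do rewrite (unsplitK (inl _)).
  under [X in _ + X]eq_bigr do rewrite (unsplitK (inr _)).
  by rewrite -!mulr_sumr c1 c1' !mulr1 subrK.
- rewrite big_split_ord !scaler_sumr; congr (_ + _); apply: eq_bigr => i _ /=.
    by rewrite (unsplitK (inl i)) scalerA.
  by rewrite (unsplitK (inr i)) scalerA.
Qed.

Lemma conv_hull_dot_le A x v b : (forall a, A a -> dot v a <= b) ->
  conv_hull A x -> dot v x <= b.
Proof.
move=> Ab [k [w [c [Aw c0 c1 ->]]]]; rewrite dot_sumr -[b]mul1r -c1 mulr_suml.
by apply: ler_sum => i _; rewrite dotZr ler_wpM2l // Ab.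
Qed.

Lemma aff_indep_le k (p : 'I_k.+1 -> 'rV[R]_n) : aff_indep p -> (k <= n)%N.
Proof. by rewrite /aff_indep /row_free => /eqP <-; exact: rank_leq_col. Qed.

Lemma has_dim_move A k (B : 'M[R]_(k, n)) x e : row_free B -> e != 0 ->
  A x -> (forall i, A (x + e *: row i B)) ->
  exists2 p : 'I_k.+1 -> 'rV[R]_n, forall i, A (p i) & aff_indep p.
Proof.
move=> fB e0 Ax Ai.
exists (fun i => if unlift ord0 i is Some j then x + e *: row j B else x) => [i|].
  by case: unlift.
rewrite /aff_indep.
have -> : (\matrix_(i < k) ((if unlift ord0 (lift ord0 i) is Some j
    then x + e *: row j B else x) -
    (if unlift ord0 (@ord0 k) is Some j then x + e *: row j B else x))) = e *: B.
  apply/row_matrixP => i; rewrite rowK liftK unlift_none addrC addKr.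
  by apply/rowP => j; rewrite !mxE.
by rewrite /row_free mxrank_scale_nz.
Qed.

End Conv.

(** * Vertices and facets of an irredundant system *)

Section HPolyFacets.
Variables (R : realType) (n m : nat) (u : 'I_m -> 'rV[R]_n) (h : 'rV[R]_m).
Hypothesis uN : normal_system u.
Hypothesis irr : irredundant u h.

Let u_unit i : dot (u i) (u i) = 1. Proof. by case: uN. Qed.
Let u_span : pos_spanning u. Proof. by case: uN. Qed.

(** A point whose active normals do not span lies between the two exit points in directions [d] and
    [- d] orthogonal to them; both have larger active sets, so induction applies. *)
Lemma hpoly_vertices : hpoly u h = conv_hull (vertices u h).
Proof.
apply/seteqP; split; last first.
  by move=> x hx i; apply: conv_hull_dot_le hx => y [hy _]; exact: hy.
apply: active_ind => x hx IH.
have [sx|/not_spanning[d d0 hd]] := pselect (spanning u (active u h x)).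
  exact: conv_hull_mem.
have nd0 : - d != 0 by rewrite oppr_eq0.
have nhd i : i \in active u h x -> dot (u i) (- d) = 0.
  by move=> /hd; rewrite dotNr => ->; rewrite oppr0.
have [t [t0 hy [i id iy]]] := ray_hit u_span hx d0.
have [s [s0 hz [j jd jz]]] := ray_hit u_span hx nd0.
have Ky := IH _ hy (active_hit hd id iy); have Kz := IH _ hz (active_hit nhd jd jz).
have t_gt0 : 0 < t.
  rewrite lt_neqAle t0 andbT; apply: contraTneq iy => <-.
  by rewrite scale0r addr0; apply: contraTN id => /hd ->; rewrite ltxx.
have st : 0 < s + t by rewrite ltr_wpDl.
have e1 : 0 <= t / (s + t) <= 1.
  by rewrite divr_ge0 ?(ltW st) //= ler_pdivrMr // mul1r lerDr.
have -> : x = (1 - t / (s + t)) *: (x + t *: d) + t / (s + t) *: (x + s *: - d).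
  rewrite !scalerDr addrACA -scalerDl subrK scale1r -[LHS]addr0; congr (_ + _).
  rewrite scalerN scalerN !scalerA -scalerBl -[LHS](scale0r d); congr (_ *: _).
  by field; rewrite gt_eqF.
exact: conv_hull_segment.
Qed.

Lemma hpoly_has_dim : has_dim (hpoly u h) n.
Proof.
split; last by case=> p _ /aff_indep_le; rewrite ltnn.
have [[q hq] _] := irr; have hqx : hpoly u h q by move=> i; exact: ltW.
have [i|e e0 he] := for_small_ex (@for_small_forall R 'I_n
  (fun i e => hpoly u h (q + e *: row i 1%:M)) _).
  have [|e0 e00 he] := @active_move R n m u h q (row i 1%:M) hqx _.
    by move=> j /activeP /eqP; rewrite lt_eqF.
  by exists e0 => // e /he[].
apply: (@has_dim_move _ _ _ _ 1%:M q e) => //; last by rewrite gt_eqF.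
by rewrite row_free_unit unitmx1.
Qed.

Lemma hpoly_full_polytope : full_polytope (hpoly u h).
Proof.
split; last exact: hpoly_has_dim.
by exists (vertices u h); [exact: finite_vertices|exact: hpoly_vertices].
Qed.

Lemma exposed_face_normal i : exposed_face (hpoly u h) (u i) = tight_face u h [set i].
Proof.
have [p pi hp] := irr.2 i.
rewrite (@tight_face_exposed _ _ _ u h [set i] p) ?big_set1 //; split=> [j|].
  by have [->|/hp/ltW//] := eqVneq j i; rewrite pi.
by rewrite finset.sub1set; exact/activeP.
Qed.

Lemma orthogonal_basis v k : v != 0 -> k.+1 = n ->
  exists2 B : 'M[R]_(k, n), row_free B & forall i, dot v (row i B) = 0.
Proof.
move=> v0 kn; have rk : \rank (kermx v^T) = k.
  by rewrite mxrank_ker mxrank_tr rank_rV v0 -kn subn1.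
rewrite -{k kn}rk; exists (row_base (kermx v^T)); first exact: row_base_free.
move=> i; rewrite dotC; have : row i (row_base (kermx v^T)) *m v^T = 0.
  by apply/sub_kermxP; apply: submx_trans (row_sub _ _) _; rewrite eq_row_base.
by rewrite dot_mulmx => /matrixP/(_ 0 0); rewrite !mxE eqxx mulr1n.
Qed.

(** From the point where only [i] is tight one can move in all [k] directions orthogonal to [u i].
    Conversely, [n] independent differences inside the face would all be orthogonal to [u i],
    forcing [u i = 0]. *)
Lemma tight_face_has_dim i k : k.+1 = n -> has_dim (tight_face u h [set i]) k.
Proof.
move=> kn; have ui0 := normal_system_neq0 i uN.
split; last first.
  case=> p Fp /eqP rp; have := ui0; rewrite -trmx_eq0.
  set D := (X in \rank X) in rp.
  have fD : row_full D by rewrite /row_full rp kn.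
  have : D *m (u i)^T = 0.
    apply/row_matrixP => j; rewrite row_mul rowK row0 dot_mulmx dotC dotBr.
    have act j' : dot (u i) (p j') = h 0 i.
      by apply/activeP; have [_] := Fp j'; rewrite finset.sub1set.
    by rewrite !act subrr; apply/matrixP => a b; rewrite !mxE mul0rn.
  move/(congr1 (mulmx (pinvmx D))).
  by rewrite mulmxA mulVpmx // mul1mx mulmx0 => ->; rewrite eqxx.
have [B fB hB] := orthogonal_basis ui0 kn.
have [p pi hp] := irr.2 i.
have Fp : hpoly u h p by move=> j; have [->|/hp/ltW//] := eqVneq j i; rewrite pi.
have ap : active u h p = [set i]%SET.
  apply/setP => j; rewrite !inE; have [->|/hp/lt_eqF//] := eqVneq j i.
  by rewrite pi eqxx.
have hB' j i' : i' \in active u h p -> dot (u i') (row j B) = 0.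
  by rewrite ap inE => /eqP ->.
have [j|e e0 he] := for_small_ex (@for_small_forall R 'I_k
  (fun j e => tight_face u h [set i] (p + e *: row j B)) _).
  have [|e0 e00 he] := @active_move R n m u h p (row j B) Fp _.
    by move=> i' /hB' ->.
  exists e0 => // e /he[hpe _]; split=> //.
  by rewrite -ap; apply: active_ray => i'; exact: hB'.
apply: (@has_dim_move _ _ _ _ B p e) => //; first by rewrite gt_eqF.
by split=> //; rewrite ap.
Qed.

(** For the inclusion from left to right: the directions of a facet have a one-dimensional
    orthogonal complement, which contains both its unit normal [v] and any [u i] tight on the whole
    facet. *)
Lemma hpoly_facet_normals : facet_normals (hpoly u h) = range u.
Proof.
apply/seteqP; split; last first.
  move=> _ [i _ <-]; exists (tight_face u h [set i]).
    split; last first.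
      have n0 : (0 < n)%N.
        case: (posnP n) => // n0; exfalso; have := u_unit i.
        rewrite /dot big1 => [/eqP|j _]; first by rewrite eq_sym oner_eq0.
        by exfalso; case: j; rewrite n0.
      by exists n.-1; [exact: prednK|apply: tight_face_has_dim; exact: prednK].
    by right; exists (u i); rewrite exposed_face_normal.
  by split; [exact/enorm_eq1/u_unit|rewrite exposed_face_normal].
move=> v [F [_ [k kn Fk]] [/enorm_eq1 vv Fv]].
have [[p Fp /eqP rp] _] := Fk.
have [|x Fx] := @exposed_face_active _ _ _ u h v.
  by rewrite -Fv; exists (p ord0); exact: Fp.
rewrite -Fv => eF.
have [q hq] := irr.1.
(* With no tight index the facet would be the whole polyhedron, which has dimension [n]. *)
have [i ix] : exists i, i \in active u h x.
  apply/set0Pn; apply/eqP => ax0; have [[p' Fp' ap'] _] := hpoly_has_dim.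
  case: Fk => _; rewrite kn; case; exists p' => // j; rewrite eF ax0.
  by split; [exact: Fp'|exact: finset.sub0set].
exists i => //.
set D := (X in \rank X) in rp.
have orth w c : (forall y, F y -> dot w y = c) -> (w <= kermx D^T)%MS.
  move=> hw; apply/sub_kermxP; rewrite -[w]trmxK -trmx_mul -[RHS]trmx0; congr trmx.
  apply/row_matrixP => j; rewrite row_mul rowK row0 dot_mulmx dotC dotBr !hw //.
  by rewrite subrr; apply/matrixP => a b; rewrite !mxE mul0rn.
have vK : (v <= kermx D^T)%MS.
  apply: (@orth _ (dot v x)) => y; rewrite Fv => -[hy ymax].
  by apply/eqP; rewrite eq_le ymax ?andbT; case: Fx => // hx xmax; exact: xmax.
have uK : (u i <= kermx D^T)%MS.
  apply: (@orth _ (h 0 i)) => y; rewrite eF => -[hy /fintype.subsetP xy].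
  by apply/activeP/xy.
have ui0 := normal_system_neq0 i uN.
have Ku : (kermx D^T <= u i)%MS.
  have [_ <-] := mxrank_leqif_sup uK.
  by rewrite mxrank_ker mxrank_tr rp rank_rV ui0 -kn subSnn.
have /sub_rVP[c vc] := submx_trans vK Ku.
have cc : c * c = 1 by move: vv; rewrite vc dotZl dotZr u_unit mulr1.
(* The interior point [q] excludes [c = -1]. *)
have cpos : 0 < c.
  have [hx /(_ q)] := Fx; have := hq i; have /activeP <- := ix.
  rewrite vc !dotZl => lq /(_ (fun j => ltW (hq j))) hc; nra.
suff c1 : c = 1 by rewrite vc c1 scale1r.
nra.
Qed.

End HPolyFacets.

(** * Facet representation *)

Lemma card_image_ord (T : Type) (m k : nat) (u : 'I_m -> T) (S : {set 'I_m}) :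
  injective u -> (u @` [set` S] #= `I_k) <-> (#|S| = k).
Proof.
move=> uI; have cu : u @` [set` S] #= [set` S] by apply: inj_card_eq => i j _ _; exact: uI.
have cS : [set` S] #= `I_#|S|.
  have <- : (fun i => index i (enum S)) @` [set` S] = `I_#|S|.
    apply/seteqP; split=> [_ [i /= iS <-]|j /= jS].
      by rewrite cardE index_mem mem_enum.
    have [i0 _] : exists i0, i0 \in S by apply/set0Pn; rewrite -card_gt0; case: #|S| jS.
    rewrite cardE in jS; exists (nth i0 (enum S) j).
      by rewrite /= -(mem_enum (mem S)) mem_nth.
    by rewrite index_uniq ?enum_uniq.
  rewrite card_eq_sym; apply: inj_card_eq => i j; rewrite !inE /= => iS jS e.
  by rewrite -(nth_index i (s := enum S) (x := i)) ?mem_enum // e nth_index ?mem_enum.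
rewrite (card_eql cu) (card_eql cS); split=> [/card_eq_II//|->].
exact: card_eqxx.
Qed.

Section Representation.
Variables (R : realType) (n : nat).

Lemma finite_dot_bounded (A : set 'rV[R]_n) d : finite_set A ->
  exists b, forall a, A a -> dot d a <= b.
Proof.
case/finite_seqP => s ->; exists (\sum_(a <- s) `|dot d a|) => a /= sa.
rewrite (big_rem a) //=; apply: le_trans (ler_norm _) _.
by rewrite lerDl sumr_ge0.
Qed.

(** A finite half-space description is normalized to unit normals and then shortened to minimal
    size. *)
Lemma polytope_hpoly (P : set 'rV[R]_n) : full_polytope P ->
  exists (m : nat) (u : 'I_m -> 'rV[R]_n) (h : 'rV[R]_m),
    [/\ normal_system u, irredundant u h & P = hpoly u h].
Proof.
move=> [[A fA PA] [[p Pp ap] _]].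
have [L hL] := conv_hull_halfspaces fA; rewrite -PA in hL.
(* The barycentre of [n+1] affinely independent points is interior: an inequality tight there is
   tight at each of them, hence has zero normal. *)
pose q := (n.+1%:R : R)^-1 *: \sum_(i < n.+1) p i.
have n1 : 0 < n.+1%:R :> R by rewrite ltr0n.
have c2E (c : 'rV[R]_n * R) : c.2 * n.+1%:R = \sum_(i < n.+1) c.2.
  by rewrite sumr_const card_ord mulr_natr.
have hp c i : c \in L -> dot c.1 (p i) <= c.2 by apply: (hL (p i)).1.
have Pq : P q.
  apply/hL => c cL; rewrite dotZr dot_sumr mulrC ler_pdivrMr // c2E.
  by apply: ler_sum => i _; exact: hp.
have hq c : c \in L -> c.1 != 0 -> dot c.1 q < c.2.
  move=> cL c0; rewrite lt_neqAle (hL q).1 // andbT; apply: contra c0 => /eqP e.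
  have tight i : dot c.1 (p i) = c.2.
    have := @psumr_eq0P _ _ xpredT (fun i => c.2 - dot c.1 (p i)) _ _ i isT.
    have -> : \sum_i (c.2 - dot c.1 (p i)) = 0.
      by rewrite sumrB -dot_sumr -c2E -e dotZr mulrAC mulVf ?gt_eqF // mul1r subrr.
    move=> H; apply/eqP; rewrite eq_sym -subr_eq0; apply/eqP.
    by apply: H => // j _; rewrite subr_ge0 hp.
  move: ap; rewrite /aff_indep; set D := (X in row_free X); rewrite row_free_unit => uD.
  rewrite -trmx_eq0 -(mulKmx uD c.1^T).
  suff -> : D *m c.1^T = 0 by rewrite mulmx0.
  apply/row_matrixP => i; rewrite row_mul rowK row0 dot_mulmx dotC dotBr !tight subrr.
  by apply/matrixP => a b; rewrite !mxE mul0rn.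
pose rep (s : seq ('rV[R]_n * R)) := [/\ uniq s,
  forall c, c \in s -> dot c.1 c.1 = 1 /\ dot c.1 q < c.2 &
  forall x, (forall c, c \in s -> dot c.1 x <= c.2) -> P x].
pose nrm (c : 'rV[R]_n * R) := ((enorm c.1)^-1 *: c.1, (enorm c.1)^-1 * c.2).
have nrm_gt0 (c : 'rV[R]_n * R) : c.1 != 0 -> 0 < (enorm c.1)^-1.
  by move=> c0; rewrite invr_gt0 sqrtr_gt0 dot_gt0.
pose L1 := undup [seq nrm c | c <- L & c.1 != 0].
pose sound (s : seq ('rV[R]_n * R)) := forall x, P x -> forall c, c \in s -> dot c.1 x <= c.2.
have : exists k, `[< exists s, [/\ rep s, sound s & size s = k] >].
  exists (size L1); apply/asboolP; exists L1; split=> //; last first.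
    move=> x Px c; rewrite mem_undup => /mapP[b]; rewrite mem_filter => /andP[b0 bL] ->.
    by rewrite dotZl ler_pM2l ?nrm_gt0 // (hL x).1.
  split; first exact: undup_uniq.
    move=> c; rewrite mem_undup => /mapP[b]; rewrite mem_filter => /andP[b0 bL] -> /=.
    split; last by rewrite dotZl ltr_pM2l ?nrm_gt0 // hq.
    have bb := ltW (dot_gt0 b0); rewrite dotZl dotZr /enorm mulrA -invfM -expr2 sqr_sqrtr //.
    by rewrite mulVf // gt_eqF // dot_gt0.
  move=> x hx; apply/hL => c cL; have [c0|c0] := eqVneq c.1 0.
    by have := (hL q).1 Pq c cL; rewrite c0 !dot0l.
  have := hx (nrm c); rewrite mem_undup map_f ?mem_filter ?c0 //= => /(_ isT).
  by rewrite dotZl ler_pM2l ?nrm_gt0.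
(* A system of inequalities of minimal size is irredundant. *)
case/ex_minnP => k /asboolP[s [[us s1 sP] Ps sk]] kmin.
(* Dropping [c] must enlarge the solution set, so some [y] violates [c] and no other inequality. *)
have viol c : c \in s -> exists2 y,
    forall c', c' \in s -> c' != c -> dot c'.1 y <= c'.2 & c.2 < dot c.1 y.
  move=> cs; pose s' := rem c s.
  have s's c' : c' \in s' -> c' \in s by exact: mem_rem.
  have : ~ rep s'.
    move=> rs'; suff /kmin : `[< exists s, [/\ rep s, sound s & size s = size s'] >].
      by rewrite /s' size_rem // -sk; case: (s) cs => // a l _; rewrite /= ltnn.
    by apply/asboolP; exists s'; split=> // x Px c' /s's; exact: Ps.
  move=> nrs'; have [y hy nPy] : exists2 y, forall c', c' \in s' -> dot c'.1 y <= c'.2 & ~ P y.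
    apply: contra_notP nrs' => nex; split; first exact: rem_uniq.
      by move=> c' /s's; exact: s1.
    by move=> x hx; apply: contrapT => nPx; apply: nex; exists x.
  exists y => [c' c's c'c|]; first by apply: hy; rewrite mem_rem_uniq // inE c'c.
  rewrite ltNge; apply/negP => cy; apply: nPy; apply: sP => c' c's.
  by have [->//|c'c] := eqVneq c' c; apply: hy; rewrite mem_rem_uniq // inE c'c.
pose t i := tnth (in_tuple s) i; pose u i := (t i).1.
pose h : 'rV[R]_(size s) := \row_i (t i).2.
have ts i : t i \in s by exact: mem_tnth.
have tI : injective t.
  by apply/injectiveP; rewrite /injectiveb /= /dinjectiveb /image_mem map_tnth_enum.
have uq i : dot (u i) q < h 0 i by rewrite mxE; have [] := s1 _ (ts i).
have PE : P = hpoly u h.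
  apply/seteqP; split=> x; first by move=> /Ps hx i; rewrite mxE; exact: hx.
  by move=> hx; apply: sP => c /(tnthP (in_tuple s))[i ->]; have := hx i; rewrite mxE.
have irr : irredundant u h.
  split; first by exists q.
  move=> i; have [y hy yi] := viol _ (ts i).
  have := uq i; rewrite mxE -/(u i) in yi *; set b := (t i).2 in yi * => qi.
  (* The segment from the interior point [q] to [y] crosses the [i]-th hyperplane at this parameter;
     as it lies strictly between 0 and 1, the other inequalities are strict there. *)
  pose e := (b - dot (u i) q) / (dot (u i) y - dot (u i) q).
  have qy : 0 < dot (u i) y - dot (u i) q by lra.
  have eE : e * (dot (u i) y - dot (u i) q) = b - dot (u i) q by rewrite divfK // gt_eqF.
  have e0 : 0 < e by rewrite divr_gt0 //; lra.
  have e1 : e < 1 by rewrite ltr_pdivrMr // mul1r; lra.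
  exists (q + e *: (y - q)) => [|j ji]; first by rewrite dotDr dotZr dotBr eE addrC subrK.
  rewrite dotDr dotZr dotBr; have := uq j; rewrite mxE -/(u j) => qj.
  have : dot (u j) y <= (t j).2 by apply: hy => //; apply: contra_neq ji; exact: tI.
  move: qj; set c := (t j).2; nra.
exists (size s), u, h; split=> //; split=> [i|i j uij|d d0].
- by have [] := s1 _ (ts i).
(* For equal normals, the two facet witnesses would make each bound smaller than the other. *)
- apply: contrapT => /eqP ij; have [pi pii pij] := irr.2 i; have [pj pjj pji] := irr.2 j.
  have := pij j; rewrite eq_sym ij -uij pii => /(_ isT); have := pji i ij.
  by rewrite uij pjj; lra.
- apply: contrapT => nd; have [b hb] := finite_dot_bounded d fA.
  have dd := dot_gt0 d0.
  (* If no normal ascends along [d], the ray from [q] stays in [P]; at this parameter it exceeds the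
     bound [b] on [dot d]. *)
  pose e := (`|b - dot d q| + 1) / dot d d.
  have eE : e * dot d d = `|b - dot d q| + 1 by rewrite divfK // gt_eqF.
  have e0 : 0 <= e by rewrite divr_ge0 ?(ltW dd) // addr_ge0.
  have : P (q + e *: d).
    rewrite PE => i; rewrite dotDr [dot _ (e *: d)]dotZr.
    have di : dot (u i) d <= 0 by rewrite leNgt; apply/negP => di; apply: nd; exists i.
    by apply: le_trans _ (ltW (uq i)); rewrite gerDl; exact: mulr_ge0_le0.
  rewrite PA => /(conv_hull_dot_le hb); rewrite dotDr [dot _ (e *: d)]dotZr eE.
  have := ler_norm (b - dot d q); lra.
Qed.

(** Both normal families are injective with the same range, so the right-hand side is merely
    reindexed. *)
Lemma polytope_hpoly_normals m (u : 'I_m -> 'rV[R]_n) (P : set 'rV[R]_n) :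
  injective u -> full_polytope P -> facet_normals P = range u ->
  exists2 h, irredundant u h & P = hpoly u h.
Proof.
move=> uI /polytope_hpoly[m' [u' [h' [nu' irr' ->]]]]; rewrite hpoly_facet_normals // => ru.
have u'I : injective u' by case: nu'.
have [k uk] : {k : 'I_m -> 'I_m' & forall i, u' (k i) = u i}.
  apply: (@choice _ _ (fun i j => u' j = u i)) => i.
  by have : range u' (u i) by [rewrite ru; exists i]; case=> j _; exists j.
have [l ul] : {l : 'I_m' -> 'I_m & forall j, u (l j) = u' j}.
  apply: (@choice _ _ (fun j i => u i = u' j)) => j.
  by have : range u (u' j) by [rewrite -ru; exists j]; case=> i _; exists i.
have kl j : k (l j) = j by apply: u'I; rewrite uk ul.
have kI : injective k by move=> i j e; apply: uI; rewrite -!uk e.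
exists (\row_i h' 0 (k i)).
  case: irr' => -[q hq] hp; split; first by exists q => i; rewrite mxE -uk.
  move=> i; have [p pi pj] := hp (k i); exists p; first by rewrite mxE -uk.
  by move=> j ji; rewrite mxE -uk; apply: pj; apply: contra_neq ji; exact: kI.
apply/seteqP; split=> x hx i; first by rewrite mxE -uk.
by have := hx (l i); rewrite mxE ul kl.
Qed.

End Representation.

(** * Combinatorial type *)

Section CombinatorialType.
Variables (R : realType) (n m : nat) (u : 'I_m -> 'rV[R]_n).
Implicit Types (x y : 'rV[R]_n) (h : 'rV[R]_m).

Lemma tight_face_subset h x y : hpoly u h x -> hpoly u h y ->
  tight_face u h (active u h x) `<=` tight_face u h (active u h y) <->
  active u h y \subset active u h x.
Proof.
move=> hx hy; split=> [/(_ x)[//|//]|yx z [hz xz]].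
by split=> //; apply: fintype.subset_trans xz.
Qed.

(** Nonempty faces correspond to the active sets of points, with inclusion reversed; equal families
    of active sets thus give isomorphic lattices. *)
Lemma comb_equiv_active h h' :
  (forall x, hpoly u h x -> exists2 y, hpoly u h' y & active u h' y = active u h x) ->
  (forall y, hpoly u h' y -> exists2 x, hpoly u h x & active u h x = active u h' y) ->
  comb_equiv (hpoly u h) (hpoly u h').
Proof.
move=> hh' h'h.
(* [f F] is cut out by the indices tight on all of [F]; the clause [F !=set0] sends the empty face
   to itself. *)
pose f (F : set 'rV[R]_n) : set 'rV[R]_n := [set y | [/\ F !=set0, hpoly u h' y &
  forall i, (forall x, F x -> i \in active u h x) -> i \in active u h' y]].
have f0 : f set0 = set0 by rewrite -subset0 => y [] [].
have fE x : hpoly u h x -> f (tight_face u h (active u h x)) = tight_face u h' (active u h x).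
  move=> hx; have Fx : tight_face u h (active u h x) x by [].
  apply/seteqP; split=> [y [_ hy xy]|y [hy /fintype.subsetP xy]].
    split=> //; apply/fintype.subsetP => i ix; apply: xy => z [_ /fintype.subsetP].
    by apply.
  by split=> // [|i hi]; [exists x|apply/xy/hi].
have f_face x : hpoly u h x -> exists y, [/\ hpoly u h' y,
    active u h' y = active u h x &
    f (tight_face u h (active u h x)) = tight_face u h' (active u h' y)].
  by move=> hx; have [y hy e] := hh' x hx; exists y; split=> //; rewrite fE // e.
have f_le F G : face (hpoly u h) F -> face (hpoly u h) G -> (F `<=` G <-> f F `<=` f G).
  move=> fF fG; have [->|/set0P/(face_active fF)[x hx ->]] := eqVneq F set0.
    by rewrite f0; split=> _ ? [].
  have [y [hy xy ->]] := f_face x hx.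
  have [->|/set0P/(face_active fG)[z hz ->]] := eqVneq G set0.
    by rewrite f0; split=> [/(_ x)|/(_ y)]; case.
  have [w [hw zw ->]] := f_face z hz.
  by rewrite !tight_face_subset // xy zw.
exists f => //; split.
- move=> F /= fF; have [->|/set0P/(face_active fF)[x hx ->]] := eqVneq F set0.
    by rewrite f0; left.
  by have [y [hy _ ->]] := f_face x hx; apply: tight_face_face; exists y.
- move=> F G /set_mem/= fF /set_mem/= fG e.
  by apply/seteqP; split; apply/f_le => //; rewrite e.
- move=> G /= fG; have [->|/set0P/(face_active fG)[y hy ->]] := eqVneq G set0.
    by exists set0 => //=; left.
  have [x hx xy] := h'h y hy; exists (tight_face u h (active u h x)) => /=.
    by apply: tight_face_face; exists x.
  by rewrite fE // xy.
Qed.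

(** Spanning gives the matrix of normals rank [n]; with at most [n] of them they form a basis. *)
Lemma spanning_solvable (S : {set 'I_m}) (c : 'I_m -> R) :
  spanning u S -> (#|S| <= n)%N -> exists z, forall i, i \in S -> dot (u i) z = c i.
Proof.
move=> sS Sn; pose M := \matrix_(i < #|S|) u (enum_val i).
have ME (z : 'rV[R]_n) i : (z *m M^T) 0 i = dot (u (enum_val i)) z.
  by rewrite dotC mxE; apply: eq_bigr => j _; rewrite !mxE.
have fM : row_free M^T.
  apply: inj_row_free => d dM; apply: sS => i iS.
  by rewrite -(enum_rankK_in iS iS) -ME dM mxE.
have : row_full M^T.
  by move: fM; rewrite /row_full /row_free => /eqP rM; rewrite eqn_leq rank_leq_col rM.
move/submx_full => /(_ _ (\row_i c (enum_val i)))/submxP[z zc].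
exists z => i iS; rewrite -(enum_rankK_in iS iS) -ME -zc mxE.
by rewrite enum_rankK_in.
Qed.

(* The admissible [h] form a cone generated by the columns of [u], their opposites
   and the unit vectors of the indices outside [S]. *)
Lemma tight_face_feasible (S : {set 'I_m}) : exists (k : nat) (b : 'I_k -> 'rV[R]_m),
  forall h, tight_face u h S !=set0 <-> forall i, dot (b i) h <= 0.
Proof.
pose col k : 'rV[R]_m := \row_i u i 0 k.
pose G : set 'rV[R]_m := range col `|` range (fun k => - col k) `|`
  (fun i => delta_mx 0 i) @` [set i | i \notin S].
have fG : finite_set G by rewrite !finite_setU; split; [split|]; exact: finite_image.
have [L hL] := weyl fG.
exists (size L), (fun i => tnth (in_tuple L) i) => h.
transitivity (pos_hull G h); last first.
  rewrite hL; split=> [hb i|hb b /(tnthP (in_tuple L))[i ->]//].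
  by apply: hb; exact: mem_tnth.
split=> [[x [hx /fintype.subsetP Sx]]|].
  (* The right-hand side splits into the values of the normals at [x] and the slacks, which vanish
     on [S]. *)
  have -> : h = \sum_k x 0 k *: col k +
      \sum_i (h 0 i - dot (u i) x) *: delta_mx 0 i.
    rewrite [X in _ + X](_ : _ = \row_i (h 0 i - dot (u i) x)); last first.
      by rewrite [RHS]row_sum_delta; apply: eq_bigr => i _; rewrite mxE.
    apply/rowP => i; rewrite !mxE summxE addrCA -[LHS]addr0; congr (_ + _).
    apply/esym/eqP; rewrite subr_eq0 /dot; apply/eqP; apply: eq_bigr => k _.
    by rewrite !mxE mulrC.
  apply: pos_hullD; apply: (big_ind (pos_hull G)) => [||k _]; try exact: pos_hull0;
    try exact: pos_hullD.
    case: (lerP 0 (x 0 k)) => xk; first by apply: pos_hullZ_mem => //; left; left; exists k.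
    rewrite -[col k]opprK scalerN -scaleNr; apply: pos_hullZ_mem.
      by rewrite oppr_ge0 ltW.
    by left; right; exists k.
  case: (boolP (k \in S)) => kS; last first.
    by apply: pos_hullZ_mem; rewrite ?subr_ge0 //; right; exists k.
  by have /activeP -> := Sx _ kS; rewrite subrr scale0r; exact: pos_hull0.
have dcol c k i : dot (u i) (c *: delta_mx 0 k) = (c *: col k) 0 i.
  by rewrite dotZr dotC dot_delta !mxE.
move: h; apply: (@pos_hull_min _ _ G (fun h => tight_face u h S !=set0)).
- exists 0; split=> [i|]; first by rewrite dot0r mxE.
  by apply/fintype.subsetP => i _; apply/activeP; rewrite dot0r mxE.
- move=> h h' [x [hx /fintype.subsetP Sx]] [x' [hx' /fintype.subsetP Sx']]; exists (x + x').
  split=> [i|]; first by rewrite dotDr mxE lerD.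
  apply/fintype.subsetP => i iS; apply/activeP; rewrite dotDr mxE.
  by have /activeP -> := Sx _ iS; have /activeP -> := Sx' _ iS.
- move=> c _ c0 [[[k _ <-]|[k _ <-]]|[i /= iS <-]].
  + exists (c *: delta_mx 0 k); split=> [i|]; first by rewrite dcol.
    by apply/fintype.subsetP => i _; apply/activeP; rewrite dcol.
  + rewrite scalerN -scaleNr.
    exists (- c *: delta_mx 0 k); split=> [i|]; first by rewrite dcol.
    by apply/fintype.subsetP => i _; apply/activeP; rewrite dcol.
  + exists 0; split=> [j|]; first by rewrite dot0r !mxE mulr_ge0.
    apply/fintype.subsetP => j jS; apply/activeP; rewrite dot0r !mxE.
    by rewrite (negbTE (_ : j != i)) ?mulr0 //; apply: contraNneq iS => <-.
Qed.

(** Among the inequalities violated at time 1, consider the first to become tight, at time [t]. All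
    inequalities still hold at [t], but this one fails at every later time, against the assumed step
    to the right. *)
Lemma affine_path (I : finType) (a b : I -> R) : (forall i, a i <= 0) ->
  (forall t, 0 <= t < 1 -> (forall i, a i + t * b i <= 0) ->
     exists2 e, 0 < e & forall i, a i + (t + e) * b i <= 0) ->
  forall i, a i + b i <= 0.
Proof.
move=> a0 step i0; rewrite leNgt; apply/negP => i0P.
have [i /= iP imin] := @arg_minP _ _ _ i0 (fun i => 0 < a i + b i) (fun i => - a i / b i) i0P.
have bP j : 0 < a j + b j -> 0 < b j by have := a0 j; lra.
have bi := bP _ iP.
set t := - a i / b i in imin.
have tb : t * b i = - a i by rewrite divfK // gt_eqF.
have t0 : 0 <= t by rewrite divr_ge0 ?oppr_ge0 // ltW.
have t1 : t < 1 by rewrite ltr_pdivrMr // mul1r; lra.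
have [|j|e e0 /(_ i)] := step t; first by rewrite t0.
  case: (lerP (a j + b j) 0) => jP; first by have := a0 j; nra.
  by have := imin j jP; rewrite ler_pdivlMr ?bP // -subr_ge0; lra.
by rewrite mulrDl tb; nra.
Qed.

End CombinatorialType.

Lemma subset_of_card (T : finType) (A : {set T}) (k : nat) : (k <= #|A|)%N ->
  exists2 S : {set T}, S \subset A & #|S| = k.
Proof.
move=> kA; exists [set:: take k (enum A)]%SET.
  by apply/fintype.subsetP => i; rewrite inE => /mem_take; rewrite mem_enum.
rewrite cardsE; have /card_uniqP -> : uniq (take k (enum A)) by rewrite take_uniq ?enum_uniq.
by rewrite size_take_min -cardE; exact/minn_idPl.
Qed.

(** * Cones of active normals and change of the right-hand side *)

Section ActiveCones.
Variables (R : realType) (n m : nat) (u : 'I_m -> 'rV[R]_n).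
Hypothesis uN : normal_system u.
Implicit Types (x y : 'rV[R]_n) (h : 'rV[R]_m) (S : {set 'I_m}).

Let u_inj : injective u. Proof. by case: uN. Qed.

(** The vector from an interior point [q] to [x] separates the active normals from 0. With [p] the
    facet witness of [i], the functional [p - x] vanishes on [u i] and is negative on the other
    active normals. *)
Lemma active_conical h x : irredundant u h -> hpoly u h x ->
  active u h x != finset.set0 -> conical_position (u @` [set` active u h x]).
Proof.
move=> [[q hq] hp] hx /set0Pn[i0 i0x].
have pos i : i \in active u h x -> 0 < dot (x - q) (u i).
  by move=> /activeP e; rewrite dotC dotBr e subr_gt0.
split; first exact: finite_image.
- have [|b b0 hb] := for_small_ex (@for_small_forall R 'I_m
    (fun i e => i \in active u h x -> e < dot (x - q) (u i)) _).
    move=> i; case: (boolP (i \in _)) => [/pos xi|_]; last exact: for_smallT.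
    by have [e e0 he] := for_small_lt 1 xi; exists e => // e' /he; rewrite add0r mulr1.
  exists (x - q), b; split.
  + by apply/eqP => xq; have := pos _ i0x; rewrite xq dot0l ltxx.
  + by rewrite dot0r.
  + by move=> _ [i /= ix <-]; exact: hb.
- move=> _ [i /= ix <-] hull; have [p pi pj] := hp i.
  have : dot (u i) (p - x) < 0 \/ u i = 0.
    apply: (pos_hull_min (K := fun y => dot y (p - x) < 0 \/ y = 0) _ _ _ hull).
    - by right.
    - move=> y z [hy|->] [hz|->]; rewrite ?add0r ?addr0; try by [left|right].
      by left; rewrite dotDl; lra.
    - move=> c _ c0 [[j /= jx <-] uji].
      have [->|c_neq0] := eqVneq c 0; first by right; rewrite scale0r.
      have c_gt0 : 0 < c by rewrite lt_neqAle eq_sym c_neq0.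
      left; rewrite dotZl pmulr_rlt0 // dotBr subr_lt0; have /activeP -> := jx; apply: pj.
      by apply/eqP => ji; apply: uji; rewrite ji.
  case=> [|/eqP]; last by rewrite (negbTE (normal_system_neq0 i uN)).
  by rewrite dotBr pi; have /activeP -> := ix; rewrite subrr ltxx.
Qed.

(** The active normals are at least as large at [x] as at the facet witness [p] of [i]; hence so is
    [u i], which attains its bound at [p]. *)
Lemma active_pos_hull h x i : irredundant u h -> hpoly u h x ->
  pos_hull (u @` [set` active u h x]) (u i) -> i \in active u h x.
Proof.
move=> [_ hp] hx hull; have [p pi pj] := hp i.
suff : dot (u i) p <= dot (u i) x.
  by rewrite pi => le; apply/activeP/eqP; rewrite eq_le le andbT; exact: hx.
move: (u i) hull; apply: pos_hull_min; first by rewrite !dot0l.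
  by move=> y z hy hz; rewrite !dotDl lerD.
move=> c _ c0 [j /= jx <-]; rewrite !dotZl ler_wpM2l //.
by have /activeP -> := jx; have [->|/pj/ltW//] := eqVneq j i; rewrite pi.
Qed.

Definition filled_cones : Prop := forall S, #|S| = n.+1 ->
  conical_position (u @` [set` S]) ->
  exists2 i, i \notin S & pos_hull (u @` [set` S]) (u i).

Hypothesis filled : filled_cones.

(** Any [n+1] active normals inherit conical position. A further normal in their positive hull would
    be active too, against the conical position of the whole active set. *)
Lemma active_card_le h x : irredundant u h -> hpoly u h x -> (#|active u h x| <= n)%N.
Proof.
move=> irr hx; rewrite leqNgt; apply/negP => ltn.
have [S /fintype.subsetP SE Sn] := subset_of_card ltn.
have ax0 : active u h x != finset.set0 by rewrite -card_gt0; case: #|_| ltn.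
have [fin [a [b [a0 b0 ab]]] noth] := active_conical irr hx ax0.
have subA : u @` [set` S] `<=` u @` [set` active u h x].
  by apply: image_subset => i /SE.
have [|i iS hull] := filled Sn.
  split; first exact: finite_image.
    by exists a, b; split=> // y /subA; exact: ab.
  move=> y Sy hull; apply: (noth y); first exact: subA.
  by apply: pos_hull_subset hull => z [Sz zy]; split=> //; exact: subA.
have iact : i \in active u h x.
  by apply: active_pos_hull irr hx _; apply: pos_hull_subset hull.
apply: (noth (u i)); first by exists i.
apply: pos_hull_subset hull => z Sz; split; first exact: subA.
by case: Sz => j /= jS <- /= /u_inj ji; move: iS; rewrite -ji jS.
Qed.

(** The active set is contained in that of a vertex, whose normals form a basis. *)
Lemma active_solvable h x (c : 'I_m -> R) : irredundant u h -> hpoly u h x ->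
  exists z, forall i, i \in active u h x -> dot (u i) z = c i.
Proof.
move=> irr hx; have [_ _ sp] := uN.
have [y hy [/fintype.subsetP xy sy]] := vertex_above sp hx.
have [z hz] := spanning_solvable c sy (active_card_le irr hy).
by exists z => i /xy; exact: hz.
Qed.

Lemma irredundant_segment h h' t : irredundant u h -> irredundant u h' ->
  0 <= t <= 1 -> irredundant u (h + t *: (h' - h)).
Proof.
move=> [[q hq] hp] [[q' hq'] hp'] /andP[t0 t1].
have conv_lt (a a' b b' : R) : a < b -> a' < b' -> a + t * (a' - a) < b + t * (b' - b).
  move=> ab ab'; have [->|t_neq0] := eqVneq t 0; first by rewrite !mul0r !addr0.
  have : 0 < t by rewrite lt_neqAle eq_sym t_neq0.
  nra.
have hE i : (h + t *: (h' - h)) 0 i = h 0 i + t * (h' 0 i - h 0 i) by rewrite !mxE.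
split=> [|i].
  exists (q + t *: (q' - q)) => i; rewrite hE dotDr dotZr dotBr.
  exact: conv_lt.
have [p pi pj] := hp i; have [p' pi' pj'] := hp' i.
exists (p + t *: (p' - p)) => [|j ji]; rewrite hE dotDr dotZr dotBr ?pi ?pi' //.
by apply: conv_lt; [exact: pj|exact: pj'].
Qed.

(** Feasibility of the tight set is a finite system of linear inequalities in the right-hand side,
    followed along the segment from [h] to [h'] by [affine_path]. *)
Lemma active_feasible h h' x : irredundant u h -> irredundant u h' ->
  hpoly u h x -> tight_face u h' (active u h x) !=set0.
Proof.
move=> irr irr' hx; have [k [b hb]] := tight_face_feasible u (active u h x).
apply/hb => i; rewrite -[h'](subrK h) addrC dotDr.
apply: (affine_path (a := fun i => dot (b i) h) (b := fun i => dot (b i) (h' - h))).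
  by move=> j; apply: (hb h).1; exists x.
move=> t /andP[t0 t1] ht; have [|y [hy /fintype.subsetP xy]] := (hb (h + t *: (h' - h))).2.
  by move=> j; rewrite dotDr dotZr.
have irrt : irredundant u (h + t *: (h' - h)).
  by apply: irredundant_segment; rewrite // t0 ltW.
(* [z] is a velocity for [y] under which all its active inequalities remain tight as the right-hand
   side moves; the others keep slack for a short time. *)
have [z hz] := active_solvable (fun i => (h' - h) 0 i) irrt hy.
have hE e j : (h + (t + e) *: (h' - h)) 0 j = (h + t *: (h' - h)) 0 j + e * (h' - h) 0 j.
  by rewrite !mxE mulrDl addrA.
have [|e e0 he] := for_small_ex (@for_small_forall R 'I_m (fun j e =>
  j \notin active u (h + t *: (h' - h)) y ->
  dot (u j) y + e * (dot (u j) z - (h' - h) 0 j) < (h + t *: (h' - h)) 0 j) _).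
  move=> j; case: (boolP (j \in _)) => [_|jy]; first exact: for_smallT.
  have [e e0 he] := for_small_lt (dot (u j) z - (h' - h) 0 j) (hpoly_lt hy jy).
  by exists e => // e' /he.
exists e => // j; rewrite -dotZr -dotDr.
have tgt l : l \in active u (h + t *: (h' - h)) y ->
    dot (u l) (y + e *: z) = (h + (t + e) *: (h' - h)) 0 l.
  by move=> ly; rewrite dotDr dotZr hE hz //; have /activeP -> := ly.
apply: (hb (h + (t + e) *: (h' - h))).1; exists (y + e *: z); split.
  move=> l; case: (boolP (l \in active u (h + t *: (h' - h)) y)) => [/tgt ->//|ly].
  by rewrite hE dotDr dotZr; have := he l ly; lra.
by apply/fintype.subsetP => l lx; apply/activeP/tgt/xy.
Qed.

Lemma active_transfer h h' x : irredundant u h -> irredundant u h' ->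
  hpoly u h x -> exists2 y, hpoly u h' y & active u h' y = active u h x.
Proof.
move=> irr irr' hx; have [y [hy /fintype.subsetP xy]] := active_feasible irr irr' hx.
(* Moving along [z] keeps the prescribed indices tight and makes every other active one slack. *)
have [z hz] := active_solvable (fun i => if i \in active u h x then 0 else -1) irr' hy.
have [|e e0 [he ae]] := for_small_ex (active_move (d := z) hy _).
  by move=> i /hz ->; case: ifP => // _; rewrite lerN10.
exists (y + e *: z) => //; rewrite ae; apply/setP => i; rewrite inE.
case: (boolP (i \in active u h x)) => ix.
  by rewrite xy //= hz ?ix ?xy //= eqxx.
apply/negbTE; apply/negP => /andP[iy]; rewrite hz // (negbTE ix).
by rewrite oppr_eq0 oner_eq0.
Qed.

End ActiveCones.

(** * Facets through a common face, in terms of the face order *)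

Section FaceOrder.
Variables (R : realType) (n : nat).
Implicit Types P Q F G H : set 'rV[R]_n.

Definition bottom_face P F : Prop := forall G, face P G -> F `<=` G.

Definition top_face P F : Prop := forall G, face P G -> G `<=` F.

Definition coatom P G : Prop := [/\ face P G, ~ top_face P G &
  forall H, face P H -> G `<=` H -> H `<=` G \/ top_face P H].

(** Lattice form of [k] distinct facets having a common point, hence invariant under [comb_equiv];
    not being a bottom face means being nonempty. *)
Definition common_coatoms P (k : nat) : Prop :=
  exists (F : set 'rV[R]_n) (G : 'I_k -> set 'rV[R]_n),
    [/\ face P F, ~ bottom_face P F, injective G &
        forall i, coatom P (G i) /\ F `<=` G i].

Lemma comb_equiv_sym P Q : comb_equiv P Q -> comb_equiv Q P.
Proof.
move=> [f [ff fI fS] fle].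
have [g hg] : {g : set 'rV[R]_n -> set 'rV[R]_n &
    forall G, face Q G -> face P (g G) /\ f (g G) = G}.
  apply: (@choice _ _ (fun G F => face Q G -> face P F /\ f F = G)) => G.
  have [/fS[F fF <-]|nG] := pselect (face Q G); first by exists F.
  by exists set0.
exists g; first split.
- by move=> G /= /hg[].
- move=> G G' /set_mem/= qG /set_mem/= qG' e.
  by rewrite -(hg G qG).2 -(hg G' qG').2 e.
- move=> F /= pF; have qF := ff _ pF; have [pgF e] := hg _ qF.
  by exists (f F) => //; apply: fI; rewrite ?inE.
move=> F G /hg[pF eF] /hg[pG eG].
by rewrite (fle _ _ pF pG) eF eG.
Qed.

Lemma comb_equiv_common_coatoms P Q k :
  comb_equiv P Q -> common_coatoms P k -> common_coatoms Q k.
Proof.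
move=> [f [ff fI fS] fle] [F [G [fF nbF GI hG]]].
have ftop H : face P H -> top_face P H <-> top_face Q (f H).
  move=> pH; split=> tH K.
    by move=> /fS[K' /= pK' <-]; apply: (fle _ _ pK' pH).1; exact: tH.
  by move=> pK; apply: (fle _ _ pK pH).2; apply/tH/ff.
exists (f F), (f \o G); split.
- exact: ff.
- move=> bF; apply: nbF => H pH; apply: (fle _ _ fF pH).2; apply: bF; exact: ff.
- move=> i j /= e; apply: GI; have [[pi _ _] _] := hG i; have [[pj _ _] _] := hG j.
  by apply: fI; rewrite ?inE.
- move=> i; have [[pi nt cG] FG] := hG i; split; last exact: (fle _ _ fF pi).1.
  split; [exact: ff|by rewrite -ftop|].
  move=> _ /fS[H /= pH <-] /(fle _ _ pi pH) /(cG _ pH)[HG|tH].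
    by left; exact: (fle _ _ pH pi).1.
  by right; rewrite -ftop.
Qed.

End FaceOrder.

Section CommonFacets.
Variables (R : realType) (n m : nat) (u : 'I_m -> 'rV[R]_n) (h : 'rV[R]_m).
Hypothesis irr : irredundant u h.

Let facet_point i : exists2 p, hpoly u h p & active u h p = [set i]%SET.
Proof.
have [p pi pj] := irr.2 i; exists p.
  by move=> j; have [->|/pj/ltW//] := eqVneq j i; rewrite pi.
apply/setP => j; rewrite !inE; have [->|/pj/lt_eqF//] := eqVneq j i.
by rewrite pi eqxx.
Qed.

Let facet_face i : face (hpoly u h) (tight_face u h [set i]).
Proof.
have [p hp ap] := facet_point i; apply: tight_face_face.
by exists p; rewrite /tight_face /= ap.
Qed.

Let top_hpoly : top_face (hpoly u h) (hpoly u h).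
Proof. by move=> F [->//|[v ->]] x []. Qed.

Let face_hpoly : face (hpoly u h) (hpoly u h).
Proof.
right; exists 0; apply/seteqP; split=> [x hx|x []//].
by split=> // y _; rewrite !dot0l.
Qed.

Let facet_not_top i : ~ top_face (hpoly u h) (tight_face u h [set i]).
Proof.
have [[q hq] _] := irr; move=> /(_ _ face_hpoly q)[|_]; first by move=> j; exact: ltW.
by rewrite finset.sub1set => /activeP/eqP; rewrite lt_eqF.
Qed.

(** A face containing the [i]-th facet contains a point where only [i] is tight, so it is that facet
    or the whole polyhedron. *)
Lemma active_common_coatoms x (S : {set 'I_m}) : hpoly u h x -> S \subset active u h x ->
  common_coatoms (hpoly u h) #|S|.
Proof.
move=> hx Sx; exists (tight_face u h S), (fun i => tight_face u h [set enum_val i]).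
split.
- by apply: tight_face_face; exists x.
- by move=> /(_ set0 (or_introl erefl) x)[].
- move=> i j /= e; have [p hp ap] := facet_point (enum_val i).
  have : tight_face u h [set enum_val i] p by split; rewrite ?ap.
  by rewrite e => -[_]; rewrite ap finset.sub1set inE => /eqP/enum_val_inj.
- move=> i; split; last first.
    move=> y [hy Sy]; split=> //; apply: fintype.subset_trans Sy.
    by rewrite finset.sub1set enum_valP.
  split; [exact: facet_face|exact: facet_not_top|].
  have [p hp ap] := facet_point (enum_val i).
  have Fp : tight_face u h [set enum_val i] p by split; rewrite ?ap.
  move=> H fH GH; have [|y hy HE] := face_active fH; first by exists p; exact: GH.
  have : active u h y \subset [set enum_val i]%SET.
    by have := GH p Fp; rewrite HE => -[_]; rewrite ap.
  rewrite finset.subset1 => /orP[/eqP ay|/eqP ay]; first by left; rewrite HE ay.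
  right; suff -> : H = hpoly u h by [].
  by rewrite HE ay; apply/seteqP; split=> [z []//|z hz]; split=> //; exact: finset.sub0set.
Qed.

(** A coatom containing a nonempty face has a tight index [j], so it lies in the [j]-th facet and
    equals it by maximality. *)
Lemma common_coatoms_active k : common_coatoms (hpoly u h) k ->
  exists2 x, hpoly u h x & (k <= #|active u h x|)%N.
Proof.
move=> [F [G [fF nbF GI hG]]].
have [x Fx] : F !=set0.
  by apply/set0P/eqP => F0; apply: nbF; rewrite F0 => H _ ? [].
have GE i : exists j, G i = tight_face u h [set j].
  have [[fG ntG cG] FG] := hG i.
  have [|y hy yE] := face_active fG; first by exists x; exact: FG.
  have [ay|[j jy]] := finset.set_0Vmem (active u h y).
    case: ntG; suff -> : G i = hpoly u h by [].
    by rewrite yE ay; apply/seteqP; split=> [z []//|z hz]; split=> //; exact: finset.sub0set.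
  exists j; have Gj : G i `<=` tight_face u h [set j].
    rewrite yE => z [hz yz]; split=> //; apply: fintype.subset_trans yz.
    by rewrite finset.sub1set.
  have [jG|/facet_not_top//] := cG _ (facet_face j) Gj.
  by apply/seteqP.
have [c cE] := choice GE.
have cI : injective c by move=> i j e; apply: GI; rewrite !cE e.
have cx i : c i \in active u h x.
  by have := (hG i).2 _ Fx; rewrite cE => -[_]; rewrite finset.sub1set.
exists x; first exact: top_hpoly fF _ Fx.
rewrite -[k]card_ord -(card_imset _ cI); apply: subset_leq_card.
by apply/fintype.subsetP => _ /imsetP[i _ ->].
Qed.

End CommonFacets.

(** * Polytopes with prescribed normals *)

Section Perturbation.
Variables (R : realType) (n m : nat) (u : 'I_m -> 'rV[R]_n).
Hypothesis uN : normal_system u.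
Implicit Types (x : 'rV[R]_n) (h l : 'rV[R]_m) (S : {set 'I_m}).

Let u_unit i : dot (u i) (u i) = 1. Proof. by case: uN. Qed.
Let u_inj : injective u. Proof. by case: uN. Qed.

(** Strict inequalities survive; the witness on the [i]-th hyperplane follows it along the unit
    normal [u i] by [e * l 0 i]. *)
Lemma irredundant_perturb h l : irredundant u h ->
  for_small (fun e => irredundant u (h + e *: l)).
Proof.
move=> [[q hq] hp].
have small_lt a b c d : a < b -> for_small (fun e : R => a + e * c < b + e * d).
  move=> ab; have [e0 e00 he] := for_small_lt (c - d) ab.
  by exists e0 => // e /he; lra.
have qs : for_small (fun e => forall i, dot (u i) q + e * 0 < h 0 i + e * l 0 i).
  by apply: for_small_forall => i; exact: small_lt.
have [p hpi] : {p : 'I_m -> 'rV[R]_n & forall i, dot (u i) (p i) = h 0 i /\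
    forall j, j != i -> dot (u j) (p i) < h 0 j}.
  apply: (@choice _ _ (fun i p => dot (u i) p = h 0 i /\
    forall j, j != i -> dot (u j) p < h 0 j)) => i.
  by have [p pi pj] := hp i; exists p.
have ps : for_small (fun e => forall i j, j != i ->
    dot (u j) (p i) + e * (l 0 i * dot (u j) (u i)) < h 0 j + e * l 0 j).
  apply: for_small_forall => i; apply: for_small_forall => j.
  case: (eqVneq j i) => [_|ji]; first exact: for_smallT.
  by have [e0 e00 he] := small_lt _ _ (l 0 i * dot (u j) (u i)) (l 0 j) ((hpi i).2 j ji);
    exists e0 => // e /he.
have [e0 e00 he] := for_small_and qs ps; exists e0 => // e /he[qe pe].
have hE i : (h + e *: l) 0 i = h 0 i + e * l 0 i by rewrite !mxE.
split; first by exists q => i; rewrite hE; have := qe i; rewrite mulr0 addr0.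
move=> i; exists (p i + (e * l 0 i) *: u i) => [|j ji]; rewrite hE dotDr dotZr.
  by rewrite u_unit mulr1 (hpi i).1.
by rewrite -mulrA; exact: pe.
Qed.

(** The hyperplanes are avoided one by one: a small step along [l] leaves that of [l] without
    entering the earlier ones. *)
Lemma irredundant_generic h (L : seq 'rV[R]_m) : irredundant u h ->
  (forall l, l \in L -> l != 0) ->
  exists2 h', irredundant u h' & forall l, l \in L -> dot l h' != 0.
Proof.
move=> irr; elim: L => [|l L IH] L0; first by exists h.
have [|h' irr' hL] := IH; first by move=> k kL; apply: L0; rewrite inE kL orbT.
have [lh|lh] := eqVneq (dot l h') 0; last first.
  by exists h' => // k; rewrite inE => /orP[/eqP ->//|]; exact: hL.
have sL : for_small (fun e => forall k, k \in L -> dot k h' + e * dot k l != 0).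
  by apply: for_small_in => k kL; apply: for_small_neq; exact: hL.
have [e e0 [irre he]] := for_small_ex (for_small_and (irredundant_perturb l irr') sL).
exists (h' + e *: l) => // k; rewrite inE dotDr dotZr => /orP[/eqP ->|]; last exact: he.
by rewrite lh add0r mulf_neq0 ?gt_eqF // dot_gt0 // L0 // mem_head.
Qed.

(** A linear dependency among [n+1] normals must hold among their right-hand sides whenever these
    hyperplanes share a point. *)
Lemma active_dependency S : #|S| = n.+1 ->
  exists2 l, l != 0 & forall h x, S \subset active u h x -> dot l h = 0.
Proof.
move=> Sn; pose M := \matrix_(i < #|S|) u (enum_val i).
have : ~~ row_free M.
  have ltM : (\rank M < #|S|)%N by apply: leq_ltn_trans (rank_leq_col M) _; rewrite Sn.
  by rewrite /row_free neq_ltn ltM.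
rewrite -kermx_eq0 => /rowV0Pn[w /sub_kermxP wM w0].
exists (\sum_k w 0 k *: delta_mx 0 (enum_val k)).
  apply: contraNneq w0 => l0; apply/eqP/rowP => k.
  have /rowP/(_ (enum_val k)) := l0; rewrite summxE (bigD1 k) //= big1 ?addr0.
    by rewrite !mxE !eqxx mulr1.
  by move=> j jk; rewrite !mxE eqxx (inj_eq enum_val_inj) eq_sym (negbTE jk) mulr0.
move=> h x /fintype.subsetP Sx; rewrite dot_suml.
transitivity (dot (w *m M) x); last by rewrite wM dot0l.
rewrite mulmx_sum_row dot_suml; apply: eq_bigr => k _.
by rewrite !dotZl dot_delta rowK; have /activeP -> := Sx _ (enum_valP k).
Qed.

(** A generic right-hand side violates the dependencies of all [n+1]-element index sets. *)
Lemma irredundant_simple h : irredundant u h -> exists2 h', irredundant u h' &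
  forall x, hpoly u h' x -> (#|active u h' x| <= n)%N.
Proof.
move=> irr.
have [l hl] : {l : {set 'I_m} -> 'rV[R]_m & forall S, #|S| = n.+1 ->
    l S != 0 /\ forall h x, S \subset active u h x -> dot (l S) h = 0}.
  apply: (@choice _ _ (fun S l => #|S| = n.+1 ->
    l != 0 /\ forall h x, S \subset active u h x -> dot l h = 0)) => S.
  have [/active_dependency[l l0 hl]|Sn] := eqVneq #|S| n.+1; first by exists l.
  by exists 0 => /eqP; rewrite (negbTE Sn).
have [|h' irr' hL] := @irredundant_generic h
    [seq l A | A <- enum [set A : {set 'I_m} | #|A| == n.+1]%SET] irr.
  by move=> k /mapP[S]; rewrite mem_enum inE => /eqP /hl[l0 _] ->.
exists h' => // x hx; rewrite leqNgt; apply/negP => ltn.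
have [S SE Sn] : exists2 S : {set 'I_m}, S \subset active u h' x & #|S| = n.+1.
  exact: subset_of_card.
have /eqP := (hl S Sn).2 h' x SE; apply/negP/hL/map_f.
by rewrite mem_enum inE Sn.
Qed.

(* On [S] take [h = 0]; elsewhere take the support function of the body
   [conv {x_i | i notin S} + d B], where [B] is the unit ball and [x_i] is an interior
   point of the polar cone of [S] with [0 < u_i . x_i].  Its support points in distinct
   directions are distinct, so every inequality is essential. *)
Lemma conical_irredundant S : conical_position (u @` [set` S]) ->
  (forall i, i \notin S -> ~ pos_hull (u @` [set` S]) (u i)) ->
  exists h, [/\ irredundant u h, hpoly u h 0 & S \subset active u h 0].
Proof.
move=> [fS [a [b [_ b0 ab]]] noth] empty.
have aS i : i \in S -> 0 < dot (u i) a.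
  move=> iS; rewrite dotC; apply: lt_trans (ab (u i) _); last by exists i.
  by move: b0; rewrite dot0r.
(* Subtracting a small multiple of [a], positive on all normals of [S], makes weak inequalities
   strict. *)
have perturb (P : pred 'I_m) z i : 0 < dot (u i) z ->
    (forall j, j \in S -> P j -> dot (u j) z <= 0) ->
    exists2 y, 0 < dot (u i) y & forall j, j \in S -> P j -> dot (u j) y < 0.
  move=> zi zj; have niz : - dot (u i) z < 0 by rewrite oppr_lt0.
  have [e e0 he] := for_small_ex (for_small_lt (dot (u i) a) niz).
  exists (z - e *: a); first by rewrite dotBr dotZr; lra.
  by move=> j jS Pj; rewrite dotBr dotZr; have := zj j jS Pj; have := aS j jS; nra.
have [x hx] : {x : 'I_m -> 'rV[R]_n & forall i, i \notin S ->
    0 < dot (u i) (x i) /\ forall j, j \in S -> dot (u j) (x i) < 0}.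
  apply: (@choice _ _ (fun i x => i \notin S ->
    0 < dot (u i) x /\ forall j, j \in S -> dot (u j) x < 0)) => i.
  have [iS|iS] := boolP (i \in S); first by exists 0.
  have [z zi zj] := farkas fS (empty i iS); rewrite dotC in zi.
  have [|y yi yj] := @perturb xpredT z i zi.
    by move=> j jS _; rewrite dotC; apply: zj; exists j.
  by exists y => _; split=> // j jS; exact: yj.
(* [y i] is a direction into the relative interior of the [i]-th facet of the polar cone of [S]:
   Farkas' lemma gives a vector positive on [u i], and a multiple of [a] brings this value down to
   0. *)
have [y hy] : {y : 'I_m -> 'rV[R]_n & forall i, i \in S ->
    dot (u i) (y i) = 0 /\ forall j, j \in S -> j != i -> dot (u j) (y i) < 0}.
  apply: (@choice _ _ (fun i y => i \in S ->
    dot (u i) y = 0 /\ forall j, j \in S -> j != i -> dot (u j) y < 0)) => i.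
  have [iS|iS] := boolP (i \in S); last by exists 0.
  have fSi : finite_set (u @` [set` S] `\ u i) by exact: finite_setD.
  have [z zi zj] := farkas fSi (noth _ (ex_intro2 _ _ i iS erefl)); rewrite dotC in zi.
  have [|y yi yj] := @perturb (fun j => j != i) z i zi.
    move=> j jS ji; rewrite dotC; apply: zj; split; first by exists j.
    by move=> /u_inj/eqP; rewrite (negbTE ji).
  have ai := aS i iS; pose c := dot (u i) y / dot (u i) a.
  have c0 : 0 < c by rewrite divr_gt0.
  exists (y - c *: a) => _; split; first by rewrite dotBr dotZr divfK ?subrr // gt_eqF.
  move=> j jS ji; rewrite dotBr dotZr; have := yj j jS ji; have := aS j jS; nra.
have [d d0 hd] : exists2 d : R, 0 < d & forall i j k, i \notin S -> j \in S ->
    dot (u j) (x i + d *: u k) < 0.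
  apply: for_small_ex; apply: for_small_forall => i; apply: for_small_forall => j.
  apply: for_small_forall => k.
  have [iS|iS] := boolP (i \in S); first exact: for_smallT.
  have [jS|jS] := boolP (j \in S); last exact: for_smallT.
  have [e0 e00 he] := for_small_lt (dot (u j) (u k)) ((hx i iS).2 j jS).
  by exists e0 => // e /he; rewrite dotDr dotZr.
(* [x (w k)] is a support point of the chosen points in direction [u k]. *)
have [w hw] : {w : 'I_m -> 'I_m & forall k, k \notin S -> w k \notin S /\
    forall i, i \notin S -> dot (u k) (x i) <= dot (u k) (x (w k))}.
  apply: (@choice _ _ (fun k w => k \notin S -> w \notin S /\
    forall i, i \notin S -> dot (u k) (x i) <= dot (u k) (x w))) => k.
  have [kS|kS] := boolP (k \in S); first by exists k.
  have [w wS wmax] := @arg_maxP _ _ _ k (fun i => i \notin S) (fun i => dot (u k) (x i)) kS.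
  by exists w.
pose h : 'rV[R]_m := \row_k (if k \in S then 0 else dot (u k) (x (w k)) + d).
have hS k : k \in S -> h 0 k = 0 by rewrite mxE => ->.
have hN k : k \notin S -> h 0 k = dot (u k) (x (w k)) + d by rewrite mxE => /negbTE ->.
have h_gt0 k : k \notin S -> 0 < h 0 k.
  move=> kS; rewrite hN //; have [wS /(_ k kS)] := hw k kS; have := (hx k kS).1; lra.
have scale z : for_small (fun e : R => forall k, k \notin S -> e * dot (u k) z < h 0 k).
  apply: for_small_forall => k; have [kS|kS] := boolP (k \in S); first exact: for_smallT.
  have [e e0 he] := for_small_lt (dot (u k) z) (h_gt0 k kS).
  by exists e => // e' /he; rewrite add0r.
exists h; split; last first.
- by apply/fintype.subsetP => i iS; apply/activeP; rewrite dot0r hS.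
- move=> i; rewrite dot0r; have [iS|iS] := boolP (i \in S); first by rewrite hS.
  exact/ltW/h_gt0.
split.
  have [e e0 he] := for_small_ex (scale (- a)); exists (e *: - a) => i; rewrite dotZr.
  have [iS|iS] := boolP (i \in S); last exact: he.
  by rewrite hS // dotNr; have := aS i iS; nra.
move=> i; have [iS|iS] := boolP (i \in S).
  have [e e0 he] := for_small_ex (scale (y i)); have [yi yj] := hy i iS.
  exists (e *: y i) => [|j ji]; rewrite dotZr; first by rewrite yi mulr0 hS.
  have [jS|jS] := boolP (j \in S); last exact: he.
  by rewrite hS // pmulr_rlt0 // yj.
have [wS wmax] := hw i iS.
(* This is the support point of the body in direction [u i]; distinct unit normals have product
   below 1, so the other inequalities outside [S] are strict. *)
exists (x (w i) + d *: u i) => [|j ji]; first by rewrite dotDr dotZr u_unit mulr1 hN.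
have [jS|jS] := boolP (j \in S); first by rewrite hS //; exact: hd.
rewrite hN // dotDr dotZr; have := (hw j jS).2 _ wS.
have : dot (u j) (u i) < 1 by apply: dot_unit_lt1 => //; rewrite (inj_eq u_inj).
nra.
Qed.

End Perturbation.

Theorem theorem5 (R : realType) (n : nat) (P : set 'rV[R]_n)
    (hP : full_polytope P) :
  monotypic P <->
  (forall A : set 'rV[R]_n,
     A `<=` facet_normals P -> A #= `I_n.+1 -> conical_position A ->
     exists u, [/\ facet_normals P u, ~ A u & pos_hull A u]).
Proof.
have [m [u [h [uN irr PE]]]] := polytope_hpoly hP.
have uI : injective u by case: uN.
have NP : facet_normals P = range u by rewrite PE hpoly_facet_normals.
rewrite NP; split=> [mono A AN cA conA|filled Q fQ NQ].
  pose S := [set i | `[< A (u i) >]]%SET.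
  have AE : A = u @` [set` S].
    apply/seteqP; split=> [v Av|v [i /=]]; last by rewrite inE => /asboolP Ai <-.
    by have [i _ iv] := AN v Av; exists i => //=; rewrite inE iv; apply/asboolP.
  have Sn : #|S| = n.+1 by move: cA; rewrite AE card_image_ord.
  apply: contrapT => nex.
  have [|i iS hull|h1 [irr1 h10 S0]] := @conical_irredundant _ _ _ u uN S.
  - by rewrite -AE.
  - apply: nex; exists (u i); rewrite AE; split=> //.
    by case=> j /= jS /uI ji; rewrite -ji jS in iS.
  have [h2 irr2 simple2] := irredundant_simple uN irr.
  have equivP h' : irredundant u h' -> comb_equiv (hpoly u h') P.
    move=> irr'; apply: mono; first exact: hpoly_full_polytope.
    by rewrite NP hpoly_facet_normals.
  (* The [n+1] facets meeting at the origin are carried through [P] to the polytope of [h2], where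
     at most [n] facets meet. *)
  have := active_common_coatoms irr1 h10 S0; rewrite Sn.
  move/(comb_equiv_common_coatoms (equivP _ irr1)).
  move/(comb_equiv_common_coatoms (comb_equiv_sym (equivP _ irr2))).
  by move/(common_coatoms_active irr2) => [x /simple2 le /leq_trans/(_ le)]; rewrite ltnn.
have filledS : filled_cones u.
  move=> S Sn conS; have [||v [[i _ <-] iS hull]] := filled (u @` [set` S]) _ _ conS.
  - by move=> _ [i _ <-]; exists i.
  - exact/card_image_ord.
  by exists i => //; apply/negP => iS'; apply: iS; exists i.
rewrite NP in NQ; have [h' irr' ->] := polytope_hpoly_normals uI fQ NQ.
by rewrite PE; apply: comb_equiv_active => x; apply: active_transfer.
Qed.
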